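(* Let $\mathcal P\subseteq\mathbb R^d$ and let $\mathbf A:\mathcal P\to\mathbb C^{N\times N}$ be a Hermitian-matrix-valued function that is real-analytic in an open neighborhood of $\boldsymbol\mu_0\in\mathcal P$, with expansion $\mathbf A(\boldsymbol\mu)=\sum_{\boldsymbol\beta\in\mathbb N_0^d}(\boldsymbol\mu-\boldsymbol\mu_0)^{\boldsymbol\beta}\mathbf A^{(\boldsymbol\beta)}$. Assume that $\lambda_0$ is an isolated eigenvalue of $\mathbf A(\boldsymbol\mu_0)$ with multiplicity $m_0\in\mathbb N$, and let $\mathbf P_0$ be the total (orthogonal) eigenprojector onto the eigenspace associated with $\lambda_0$. Then, for $\boldsymbol\mu$ in a sufficiently small neighborhood of $\boldsymbol\mu_0$, there exists an analytic orthogonal-projector-valued function $\mathbf P_0(\boldsymbol\mu)$ commuting with $\mathbf A(\boldsymbol\mu)$ such that $\mathbf P_0(\boldsymbol\mu_0)=\mathbf P_0$. The coefficient matrices of its power series expansion $\mathbf P_0(\boldsymbol\mu)=\sum_{\boldsymbol\beta}(\boldsymbol\mu-\boldsymbol\mu_0)^{\boldsymbol\beta}\mathbf P_0^{(\boldsymbol\beta)}$ are given by $\mathbf P_0^{(\mathbf 0)}=\mathbf P_0$ and $$\mathbf P_0^{(\boldsymbol\beta)}=-\sum_{p=1}^{|\boldsymbol\beta|}(-1)^p\sum_{\substack{\boldsymbol\nu_1,\dots,\boldsymbol\nu_p\in\mathbb N_0^d\setminus\{\mathbf 0\},\ \boldsymbol\nu_1+\dots+\boldsymbol\nu_p=\boldsymbol\beta\\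 k_1,\dots,k_{p+1}\in\mathbb N_0,\ k_1+\dots+k_{p+1}=p}}\mathbf S_0^{(k_1)}\mathbf A^{(\boldsymbol\nu_1)}\mathbf S_0^{(k_2)}\cdots\mathbf S_0^{(k_p)}\mathbf A^{(\boldsymbol\nu_p)}\mathbf S_0^{(k_{p+1})}\quad(|\boldsymbol\beta|\ge1).$$ For each $\boldsymbol\beta=(\beta_1,\dots,\beta_d)\in\mathbb N_0^d$, the coefficient matrix $\mathbf P_0^{(\boldsymbol\beta)}$ is Hermitian, has rank at most $m_0\prod_{j=1}^d(\beta_j+1)$, and, for $\boldsymbol\beta\ne\mathbf 0$, satisfies $$\mathbf P_0^{(\boldsymbol\beta)}=-\mathbf P_0\mathbf Z^{(\boldsymbol\beta)}\mathbf P_0+\mathbf P_0^\perp\mathbf Z^{(\boldsymbol\beta)}\mathbf P_0^\perp-\mathbf S_0\mathbf W^{(\boldsymbol\beta)}\mathbf P_0-(\mathbf S_0\mathbf W^{(\boldsymbol\beta)}\mathbf P_0)^*,$$ with $$\mathbf Z^{(\boldsymbol\beta)}:=\sum_{\substack{\boldsymbol\nu_1,\boldsymbol\nu_2\ne\mathbf 0\\ \boldsymbol\nu_1+\boldsymbol\nu_2=\boldsymbol\beta}}\mathbf P_0^{(\boldsymbol\nu_1)}\mathbf P_0^{(\boldsymbol\nu_2)},\qquad \mathbf W^{(\boldsymbol\beta)}:=\sum_{\substack{\boldsymbol\nu_1\ne\mathbf 0\\ \boldsymbol\nu_1+\boldsymbol\nu_2=\boldsymbol\beta}}\big(\mathbf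 A^{(\boldsymbol\nu_1)}\mathbf P_0^{(\boldsymbol\nu_2)}-\mathbf P_0^{(\boldsymbol\nu_2)}\mathbf A^{(\boldsymbol\nu_1)}\big).$$ The Ritz-value sum $\operatorname{tr}(\mathbf A(\boldsymbol\mu)\mathbf P_0(\boldsymbol\mu))$ is also analytic in a neighborhood of $\boldsymbol\mu_0$.
   Context: Multi-index notation: $|\boldsymbol\beta|=\beta_1+\dots+\beta_d$, $\boldsymbol\mu^{\boldsymbol\beta}=\mu_1^{\beta_1}\cdots\mu_d^{\beta_d}$; all multi-indices $\boldsymbol\nu_i$ lie in $\mathbb N_0^d$. Real-analytic near $\boldsymbol\mu_0$ means equal to a convergent power series in $\boldsymbol\mu-\boldsymbol\mu_0$ on a neighborhood of $\boldsymbol\mu_0$. Orthogonal projector: $\mathbf Q=\mathbf Q^2=\mathbf Q^*$; $\mathbf P_0^\perp:=\mathbf I-\mathbf P_0$. With $\mathbf A_0:=\mathbf A(\boldsymbol\mu_0)$, the reduced resolvent $\mathbf S_0$ of $\mathbf A_0$ at $\lambda_0$ is characterized by $\mathbf S_0\mathbf P_0=\mathbf P_0\mathbf S_0=\mathbf 0$ and $(\mathbf A_0-\lambda_0\mathbf I)\mathbf S_0=\mathbf S_0(\mathbf A_0-\lambda_0\mathbf I)=\mathbf I-\mathbf P_0$. Further $\mathbf S_0^{(0)}:=-\mathbf P_0$ and $\mathbf S_0^{(t)}:=\mathbf S_0^t$ for $t\in\mathbb N$, $t\ge1$. *)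

(* Defs.v *)
From HB Require Import structures.
From mathcomp Require Import all_boot all_order all_algebra.
From mathcomp Require Import all_classical all_reals all_analysis.
From mathcomp Require Import showcase.summability.
From mathcomp Require Import complex.

Set Implicit Arguments.
Unset Strict Implicit.
Unset Printing Implicit Defensive.

Import Order.TTheory GRing.Theory Num.Theory.
Import numFieldNormedType.Exports.

Local Open Scope classical_set_scope.
Local Open Scope ring_scope.
Local Open Scope complex_scope.
Local Open Scope sesquilinear_scope.

Notation multiindex d := {ffun 'I_d -> nat}.

Definition mi_deg d (b : multiindex d) : nat := (\sum_j b j)%N.

Definition mi_pow (R : realType) d (x : 'rV[R]_d) (b : multiindex d) : R :=
  \prod_j x 0 j ^+ b j.

(* Convergence is unconditional: the net of partial sums over finite sets of
   multi-indices (filter [totally]) converges to [f mu].  In finite dimension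
   this is the same as absolute convergence. *)
Definition power_series_near (R : realType) d (V : normedModType R[i])
    (f : 'rV[R]_d -> V) (mu0 : 'rV[R]_d) (c : multiindex d -> V) : Prop :=
  \forall mu \near mu0,
    partial_sum (fun b => (mi_pow (mu - mu0) b)%:C *: c b) @ totally --> f mu.

Definition real_analytic_near (R : realType) d (V : normedModType R[i])
    (f : 'rV[R]_d -> V) (mu0 : 'rV[R]_d) : Prop :=
  exists c : multiindex d -> V, power_series_near f mu0 c.

Section matrices.
Variables (R : realType) (N : nat).
Implicit Types (A P Q S : 'M[R[i]]_N) (lam : R[i]).

Definition orthogonal_projector Q : Prop := Q = Q *m Q /\ Q = Q^t*.

(* [isolated] is taken in the usual topology of the complex plane, which is
   carried by the alias [R[i]^o] *)
Definition isolated_eigenvalue A lam : Prop :=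
  isolated ([set x | eigenvalue A x] : set R[i]^o) lam.

(* [eigenspace] in mxalgebra consists of row vectors; here the range of the
   projector is the space of column eigenvectors *)
Definition eigenprojector A lam P : Prop :=
  orthogonal_projector P /\
  range (fun v : 'cV[R[i]]_N => P *m v) = [set v | A *m v = lam *: v].

Definition reduced_resolvent A lam P S : Prop :=
  [/\ S *m P = 0, P *m S = 0,
      (A - lam%:M) *m S = 1%:M - P &
      S *m (A - lam%:M) = 1%:M - P].

Definition resolvent_power P S (t : nat) : 'M[R[i]]_N :=
  if t is 0%N then - P else S ^+ t.

Variable d : nat.
Implicit Types (b : multiindex d).

(* The index set of the inner sum: [p] nonzero multi-indices adding up to [b]
   and [p + 1] natural numbers adding up to [p].  This set is finite, so the
   sum below, taken over a classical set, is an honest finite sum. *)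
Definition kato_indices b (p : nat) :=
  [set nk : {ffun 'I_p -> multiindex d} * {ffun 'I_p.+1 -> nat} |
          [/\ forall i, nk.1 i != 0, \sum_i nk.1 i = b &
                (\sum_i nk.2 i)%N = p]].
Arguments kato_indices b p : clear implicits.

Definition kato_term P S (Ac : multiindex d -> 'M[R[i]]_N) (p : nat)
    (nk : {ffun 'I_p -> multiindex d} * {ffun 'I_p.+1 -> nat}) : 'M[R[i]]_N :=
  (\prod_(i < p)
     (resolvent_power P S (nk.2 (widen_ord (leqnSn p) i)) *m Ac (nk.1 i)))
  *m resolvent_power P S (nk.2 ord_max).

Definition kato_coef P S (Ac : multiindex d -> 'M[R[i]]_N) b : 'M[R[i]]_N :=
  - \sum_(1 <= p < (mi_deg b).+1)
      (-1) ^+ p *: \sum_(nk \in kato_indices b p) kato_term P S Ac nk.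

Definition Zcoef (Pc : multiindex d -> 'M[R[i]]_N) b : 'M[R[i]]_N :=
  \sum_(n \in [set n : multiindex d * multiindex d |
                [/\ n.1 != 0, n.2 != 0 & n.1 + n.2 = b]])
    Pc n.1 *m Pc n.2.

Definition Wcoef (Ac Pc : multiindex d -> 'M[R[i]]_N) b : 'M[R[i]]_N :=
  \sum_(n \in [set n : multiindex d * multiindex d |
                n.1 != 0 /\ n.1 + n.2 = b])
    (Ac n.1 *m Pc n.2 - Pc n.2 *m Ac n.1).

End matrices.

(* Main.v *)
Require Import Defs.
From mathcomp Require Import showcase.summability.
From HB Require Import structures.
From mathcomp Require Import all_boot all_order all_algebra.
From mathcomp Require Import all_classical all_reals all_analysis.
From mathcomp Require Import complex ring lra finmap.
Set Implicit Arguments.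
Unset Strict Implicit.
Unset Printing Implicit Defensive.

Import Order.TTheory GRing.Theory Num.Theory.
Import numFieldNormedType.Exports.

Local Open Scope classical_set_scope.
Local Open Scope ring_scope.
Local Open Scope sesquilinear_scope.

(** The total eigenprojector of [A mu] near [lam0] is, up to sign, the residue
    of the resolvent of [A mu] around [lam0]. Instead of contour integrals, the
    proof works with formal series. Let [B] be the series of [A mu - lam0] in
    the parameters, [D] its constant term and [E = B - D]. The inverse of
    [D - zeta] is the Laurent series [- P0 / zeta + S0 + S0 ^ 2 zeta + ...],
    and the Neumann series [R = \sum_p (- 1) ^ p R0 (E R0) ^ p], with [R0] this
    inverse, is an inverse of [B - zeta]: a given coefficient in the parameters
    involves finitely many orders [p], since [E] has no constant term, and has
    a pole of finite order in [zeta]. The opposite of the coefficient of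
    [zeta ^ (- 1)] is [kato_series]; expanding the products gives Kato's formula
    ([kato_coefE]).

    Its algebraic properties follow from [(B - zeta) R = 1 = R (B - zeta)]. With
    [R_n] the coefficient of [zeta ^ n], this says [B R_n = R_(n - 1)] for
    nonzero [n] and [B R_0 = R_(-1) + 1], and the same on the right. Therefore
    [R_0 R_(-2) = R_1 R_(-3) = ... = 0], whence [R_(-1) R_(-1) = - R_(-1)]
    ([kato_series_idem]); and [R_(-1)] commutes with [B] ([kato_series_comm]).
    Reversing products shows that the coefficients are Hermitian
    ([kato_series_adjoint]), because those of [A] are ([hermitian_coef], by
    uniqueness of power series coefficients). The identities [P P = P] and
    [A P = P A], read coefficientwise and split into blocks with respect to
    [P0], are the recursion ([idempotent_recursion]). An idempotent series is
    equivalent to its constant term, [P = P P0 V], so a coefficient [P b] is a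
    sum of products through [P0], one for each exponent below [b]
    ([rank_idempotent_coef]).

    Convergence comes from geometric bounds on each order of the Neumann series
    ([kato_series_bound]), valid on a polydisc where [E] is small
    ([small_radius]). Sums of products of absolutely convergent families are
    the products of the sums ([sums_toM]), so that the formal identities
    become identities between [A mu] and the sum [P mu], and [A P], hence its
    trace, is analytic. *)

(** * Formal power series with non-commuting coefficients *)

(** Exponents of formal series: the natural numbers for the spectral variable,
    the multi-indices for the parameters. The finitely many ways of splitting
    an exponent are listed as a sequence, so that all convolutions are sums
    over sequences. *)
HB.mixin Record hasSplits I of GRing.Nmodule I := {
  weight : I -> nat;
  weightD : forall a b, weight (a + b) = (weight a + weight b)%N;
  weight_eq0 : forall a, (weight a == 0%N) = (a == 0);
  splits : I -> seq (I * I);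
  splits_uniq : forall a, uniq (splits a);
  mem_splits : forall a n, (n \in splits a) = (n.1 + n.2 == a) }.

#[short(type="exponentType")]
HB.structure Definition Exponent := { I of GRing.Nmodule I & hasSplits I }.

Section NatExponent.
Definition nat_splits (n : nat) := [seq (i, (n - i)%N) | i <- iota 0 n.+1].

Lemma nat_splits_uniq n : uniq (nat_splits n).
Proof. by rewrite map_inj_uniq ?iota_uniq // => i j []. Qed.

Lemma mem_nat_splits n (p : nat * nat) : (p \in nat_splits n) = (p.1 + p.2 == n).
Proof.
apply/mapP/eqP => [[i + ->]|<-].
  by rewrite mem_iota ltnS => /= /subnKC.
exists p.1; first by rewrite mem_iota /= add0n ltnS leq_addr.
by case: p => i j /=; rewrite -[(i + j)%R]/(i + j)%N addKn.
Qed.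

HB.instance Definition _ := hasSplits.Build nat
  (fun _ _ => erefl) (fun _ => erefl) nat_splits_uniq mem_nat_splits.
End NatExponent.

Section MultiindexExponent.
Variable d : nat.
Implicit Types a b : multiindex d.

Lemma mi_degD a b : mi_deg (a + b) = (mi_deg a + mi_deg b)%N.
Proof. by rewrite -big_split; apply: eq_bigr => j _; rewrite ffunE. Qed.

Lemma mi_deg_eq0 a : (mi_deg a == 0%N) = (a == 0).
Proof.
rewrite sum_nat_eq0; apply/forallP/eqP => [a0|-> j]; last by rewrite ffunE.
by apply/ffunP => j; rewrite ffunE; apply/eqP/a0.
Qed.

Lemma leq_mi_deg b j : (b j <= mi_deg b)%N.
Proof. by rewrite /mi_deg (bigD1 j) //= leq_addr. Qed.

(** The exponents below [b], listed without repetition as the elements of a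
    product of intervals: this makes their number easy to compute. *)
Definition mi_below b : seq {ffun 'I_d -> 'I_(mi_deg b).+1} :=
  enum (family (fun j => [pred k : 'I_(mi_deg b).+1 | (k <= b j)%N])).

Definition mi_splits b : seq (multiindex d * multiindex d) :=
  [seq ([ffun j => nat_of_ord (k j)], [ffun j => (b j - k j)%N])
     | k : {ffun 'I_d -> 'I_(mi_deg b).+1} <- mi_below b].

Lemma mi_splits_uniq b : uniq (mi_splits b).
Proof.
rewrite map_inj_uniq ?enum_uniq // => k l [/ffunP kl _].
by apply/ffunP => j; apply/val_inj; have := kl j; rewrite !ffunE.
Qed.

Lemma mem_mi_splits b (n : multiindex d * multiindex d) :
  (n \in mi_splits b) = (n.1 + n.2 == b).
Proof.
apply/mapP/eqP => [[k]|nb].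
  rewrite mem_enum => /familyP kb -> /=; apply/ffunP => j; rewrite !ffunE.
  by have := kb j; rewrite inE => /subnKC.
have le_nb j : (n.1 j <= b j)%N by rewrite -nb ffunE leq_addr.
have lt_n j : (n.1 j < (mi_deg b).+1)%N.
  by rewrite ltnS (leq_trans (le_nb j)) // leq_mi_deg.
exists [ffun j => Ordinal (lt_n j)].
  by rewrite mem_enum; apply/familyP => j; rewrite ffunE inE /=.
rewrite [LHS]surjective_pairing; congr pair; apply/ffunP => j.
  by rewrite !ffunE.
by rewrite !ffunE /= -nb ffunE -[(_ + _)%R]/(_ + _)%N addKn.
Qed.

Lemma size_mi_splits b : size (mi_splits b) = (\prod_(j < d) (b j).+1)%N.
Proof.
rewrite size_map -cardE card_family foldrE big_map big_enum /=.
apply: eq_bigr => j _; rewrite -sum1_card.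
rewrite (eq_bigl (fun k : 'I__ => (k < (b j).+1)%N)) //.
rewrite -(big_ord_widen _ (fun _ => 1%N)) ?sum1_card ?card_ord //.
by rewrite ltnS leq_mi_deg.
Qed.

HB.instance Definition _ := hasSplits.Build (multiindex d)
  mi_degD mi_deg_eq0 mi_splits_uniq mem_mi_splits.
End MultiindexExponent.

Lemma eq_sum_uniq (V : nmodType) (J : eqType) (r s : seq J) (F : J -> V) :
  uniq r -> uniq s -> r =i s -> \sum_(j <- r) F j = \sum_(j <- s) F j.
Proof. by move=> Ur Us rs; apply/perm_big/uniq_perm. Qed.

(** A structure rather than a bare function type, on which multiplication
    would be pointwise. *)
Record fseries (I T : Type) : Type := Series { fcoef :> I -> T }.

Lemma fseriesP (I T : Type) (f g : fseries I T) :
  (forall b, f b = g b) -> f = g.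
Proof. by case: f g => [f] [g] /= fg; congr Series; apply/funext. Qed.

HB.instance Definition _ (I T : Type) := gen_eqMixin (fseries I T).
HB.instance Definition _ (I T : Type) := gen_choiceMixin (fseries I T).

Section SeriesZmodule.
Variables (I : Type) (T : zmodType).
Implicit Types f g h : fseries I T.

Let zero : fseries I T := Series (fun=> 0).
Let opp f : fseries I T := Series (fun b => - f b).
Let add f g : fseries I T := Series (fun b => f b + g b).

Fact fseries_addA : associative add.
Proof. by move=> f g h; apply: fseriesP => b /=; rewrite addrA. Qed.
Fact fseries_addC : commutative add.
Proof. by move=> f g; apply: fseriesP => b /=; rewrite addrC. Qed.
Fact fseries_add0 : left_id zero add.
Proof. by move=> f; apply: fseriesP => b /=; rewrite add0r. Qed.
Fact fseries_addN : left_inverse zero opp add.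
Proof. by move=> f; apply: fseriesP => b /=; rewrite addNr. Qed.
HB.instance Definition _ := GRing.isZmodule.Build (fseries I T)
  fseries_addA fseries_addC fseries_add0 fseries_addN.
End SeriesZmodule.

Section SeriesRing.
Variables (I : exponentType) (T : pzRingType).
Implicit Types (f g h : fseries I T) (a b : I).

Definition fconv f g : fseries I T :=
  Series (fun b => \sum_(n <- splits b) f n.1 * g n.2).

Definition fconst (t : T) : fseries I T :=
  Series (fun b => if b == 0 then t else 0).

(** Both sides run over the triples of exponents with sum [a]. *)
Lemma splits_assoc (V : nmodType) (F : I -> I -> I -> V) a :
  \sum_(n <- splits a) \sum_(m <- splits n.2) F n.1 m.1 m.2 =
  \sum_(n <- splits a) \sum_(m <- splits n.1) F m.1 m.2 n.2.
Proof.
pose G (t : I * I * I) := F t.1.1 t.1.2 t.2.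
transitivity (\sum_(t <- [seq (n.1, m.1, m.2) | n <- splits a, m <- splits n.2])
    G t); first by rewrite big_allpairs_dep.
transitivity (\sum_(t <- [seq (m.1, m.2, n.2) | n <- splits a, m <- splits n.1])
    G t); last by rewrite big_allpairs_dep.
apply: eq_sum_uniq.
- apply: allpairs_uniq_dep => [|n _|]; rewrite ?splits_uniq //.
  move=> x y /allpairsPdep[[n1 n2] [[m1 m2] [_ + ->]]].
  rewrite mem_splits /= => /eqP <-.
  move=> /allpairsPdep[[n1' n2'] [[m1' m2'] [_ + ->]]].
  by rewrite mem_splits /= => /eqP <- [-> -> ->].
- apply: allpairs_uniq_dep => [|n _|]; rewrite ?splits_uniq //.
  move=> x y /allpairsPdep[[n1 n2] [[m1 m2] [_ + ->]]].
  rewrite mem_splits /= => /eqP <-.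
  move=> /allpairsPdep[[n1' n2'] [[m1' m2'] [_ + ->]]].
  by rewrite mem_splits /= => /eqP <- [-> -> ->].
move=> [[x y] z]; apply/allpairsPdep/allpairsPdep => -[[n1 n2] [[m1 m2]]].
  rewrite !mem_splits /= => -[/eqP na /eqP mn [-> -> ->]].
  by exists (n1 + m1, m2), (n1, m1); rewrite !mem_splits /= -addrA mn na !eqxx.
rewrite !mem_splits /= => -[/eqP na /eqP mn [-> -> ->]].
by exists (m1, m2 + n2), (m2, n2); rewrite !mem_splits /= addrA mn na !eqxx.
Qed.

Lemma splits_swap (V : nmodType) (F : I -> I -> V) a :
  \sum_(n <- splits a) F n.1 n.2 = \sum_(n <- splits a) F n.2 n.1.
Proof.
transitivity (\sum_(n <- [seq (n.2, n.1) | n <- splits a]) F n.2 n.1).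
  by rewrite big_map.
apply: eq_sum_uniq; rewrite ?splits_uniq //.
  by rewrite map_inj_uniq ?splits_uniq // => -[? ?] [? ?] [-> ->].
move=> [x y]; rewrite mem_splits /=; apply/mapP/eqP => [[[u v]]|xy].
  by rewrite mem_splits /= => /eqP <- [-> ->]; rewrite addrC.
by exists (y, x) => //; rewrite mem_splits /= addrC xy.
Qed.

Lemma sum_splits0l (V : nmodType) (F : I -> I -> V) a :
  (forall n m, n != 0 -> F n m = 0) -> \sum_(n <- splits a) F n.1 n.2 = F 0 a.
Proof.
move=> F0; have s0a : (0, a) \in splits a by rewrite mem_splits /= add0r.
rewrite (bigD1_seq (0, a)) ?splits_uniq //=.
rewrite big_seq_cond big1 ?addr0 // => -[n m]; rewrite mem_splits /=.
case/andP => /eqP nma; have [n0|/F0-> //] := eqVneq n 0.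
by rewrite -nma n0 add0r eqxx.
Qed.

Lemma sum_splits0r (V : nmodType) (F : I -> I -> V) a :
  (forall n m, m != 0 -> F n m = 0) -> \sum_(n <- splits a) F n.1 n.2 = F a 0.
Proof.
move=> F0; rewrite (splits_swap F) (sum_splits0l (F := fun n m => F m n)) //.
by move=> n m; apply: F0.
Qed.

Let convE f g b : fconv f g b = \sum_(n <- splits b) f n.1 * g n.2.
Proof. by []. Qed.

Fact convA : associative fconv.
Proof.
move=> f g h; apply: fseriesP => b; rewrite [LHS]convE [RHS]convE.
under eq_bigr do rewrite convE mulr_sumr.
rewrite (splits_assoc (fun x y z => f x * (g y * h z))).
apply: eq_bigr => n _; rewrite mulr_suml; apply: eq_bigr => m _.
by rewrite mulrA.
Qed.

Fact conv1l : left_id (fconst 1) fconv.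
Proof.
move=> f; apply: fseriesP => b.
rewrite convE (sum_splits0l (F := fun n m => fconst 1 n * f m)) /=.
  by rewrite eqxx mul1r.
by move=> n m /negPf->; rewrite mul0r.
Qed.

Fact conv1r : right_id (fconst 1) fconv.
Proof.
move=> f; apply: fseriesP => b.
rewrite convE (sum_splits0r (F := fun n m => f n * fconst 1 m)) /=.
  by rewrite eqxx mulr1.
by move=> n m /negPf->; rewrite mulr0.
Qed.

Fact convDl : left_distributive fconv +%R.
Proof.
move=> f g h; apply: fseriesP => b; rewrite /= -[RHS]big_split /=.
by apply: eq_bigr => n _; rewrite -mulrDl.
Qed.

Fact convDr : right_distributive fconv +%R.
Proof.
move=> f g h; apply: fseriesP => b; rewrite /= -[RHS]big_split /=.
by apply: eq_bigr => n _; rewrite -mulrDr.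
Qed.

HB.instance Definition _ := GRing.Zmodule_isPzRing.Build (fseries I T)
  convA conv1l conv1r convDl convDr.

Lemma fcoefM f g b : (f * g) b = \sum_(n <- splits b) f n.1 * g n.2.
Proof. by []. Qed.

Lemma fcoefD f g b : (f + g) b = f b + g b. Proof. by []. Qed.
Lemma fcoefN f b : (- f) b = - f b. Proof. by []. Qed.
Lemma fcoefB f g b : (f - g) b = f b - g b. Proof. by []. Qed.
Lemma fcoef0 b : (0 : fseries I T) b = 0. Proof. by []. Qed.

Lemma fcoef1 b : (1 : fseries I T) b = if b == 0 then 1 else 0. Proof. by []. Qed.

Lemma fcoef_sum (J : Type) (r : seq J) (Q : pred J) (F : J -> fseries I T) b :
  (\sum_(j <- r | Q j) F j) b = \sum_(j <- r | Q j) F j b.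
Proof. by elim/big_rec2: _ => // j y1 y2 _ <-. Qed.

Lemma fcoef_const t b : fconst t b = if b == 0 then t else 0. Proof. by []. Qed.

Lemma fcoef_constM t f b : (fconst t * f) b = t * f b.
Proof.
rewrite fcoefM (sum_splits0l (F := fun n m => fconst t n * f m)) /= ?eqxx //.
by move=> n m /negPf->; rewrite mul0r.
Qed.

Lemma fcoefM_const t f b : (f * fconst t) b = f b * t.
Proof.
rewrite fcoefM (sum_splits0r (F := fun n m => f n * fconst t m)) /= ?eqxx //.
by move=> n m /negPf->; rewrite mulr0.
Qed.

Lemma fcoef_signM p f b : ((-1) ^+ p * f) b = (-1) ^+ p * f b.
Proof.
elim: p => [|p IH]; first by rewrite !mul1r.
by rewrite !exprS -!mulrA !mulN1r fcoefN IH.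
Qed.

Fact fconst_is_zmod_morphism : zmod_morphism fconst.
Proof.
by move=> s t; apply: fseriesP => b; rewrite fcoefB /=; case: ifP; rewrite ?subr0.
Qed.
HB.instance Definition _ :=
  GRing.isZmodMorphism.Build T (fseries I T) fconst fconst_is_zmod_morphism.

Fact fconst_is_monoid_morphism : monoid_morphism fconst.
Proof.
split=> // s t; apply: fseriesP => b; rewrite fcoef_constM /=.
by case: ifP; rewrite ?mulr0.
Qed.
HB.instance Definition _ :=
  GRing.isMonoidMorphism.Build T (fseries I T) fconst fconst_is_monoid_morphism.

(** ** Products of several series *)

Definition fcons p a (nu : {ffun 'I_p -> I}) : {ffun 'I_p.+1 -> I} :=
  [ffun i => if unlift ord0 i is Some j then nu j else a].

Lemma fcons0 p a (nu : {ffun 'I_p -> I}) : fcons a nu ord0 = a.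
Proof. by rewrite ffunE unlift_none. Qed.

Lemma fconsS p a (nu : {ffun 'I_p -> I}) i : fcons a nu (lift ord0 i) = nu i.
Proof. by rewrite ffunE liftK. Qed.

(** The weak compositions of [b] into [p] parts. *)
Fixpoint comps p b : seq {ffun 'I_p -> I} :=
  if p is q.+1 then [seq fcons n.1 nu | n <- splits b, nu <- comps q n.2]
  else if b == 0 then [:: [ffun=> 0]] else [::].

Lemma mem_comps p b (nu : {ffun 'I_p -> I}) :
  (nu \in comps p b) = (\sum_i nu i == b).
Proof.
elim: p b nu => [|p IH] b nu /=.
  rewrite big_ord0 eq_sym; case: ifP => //= _; rewrite inE.
  by apply/eqP/ffunP => -[].
rewrite big_ord_recl; apply/allpairsPdep/eqP => [[[n m] [mu []]]|nub].
  rewrite mem_splits IH /= => /eqP <- /eqP <- ->; rewrite fcons0.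
  by congr (_ + _); apply: eq_bigr => i _; rewrite fconsS.
pose mu := [ffun i => nu (lift ord0 i)].
have mus : \sum_i mu i = \sum_i nu (lift ord0 i).
  by apply: eq_bigr => i _; rewrite ffunE.
exists (nu ord0, \sum_i mu i), mu; rewrite mem_splits IH mus nub !eqxx.
split=> //; apply/ffunP => i; rewrite ffunE.
by case: unliftP => [j|] ->; rewrite ?ffunE.
Qed.

Lemma comps_uniq p b : uniq (comps p b).
Proof.
elim: p b => [|p IH] b /=; first by case: ifP.
apply: allpairs_uniq_dep => [|n _|]; rewrite ?splits_uniq //.
move=> x y /allpairsPdep[[n m] [mu [ns ms ->]]].
move=> /allpairsPdep[[n' m'] [mu' [ns' ms' ->]]] /= /ffunP eq_c.
have en : n = n' by have := eq_c ord0; rewrite !fcons0.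
have em : mu = mu'.
  by apply/ffunP => i; have := eq_c (lift ord0 i); rewrite !fconsS.
move: ms ms'; rewrite !mem_comps /= en em => /eqP <- /eqP <-.
by [].
Qed.

Lemma fcoef_prod p (F : 'I_p -> fseries I T) b :
  (\prod_i F i) b = \sum_(nu <- comps p b) \prod_i F i (nu i).
Proof.
elim: p F b => [|p IH] F b /=.
  rewrite big_ord0 fcoef1; case: ifP => _; last by rewrite big_nil.
  by rewrite big_seq1 big_ord0.
rewrite big_ord_recl fcoefM big_allpairs_dep; apply: eq_bigr => n _.
rewrite IH mulr_sumr; apply: eq_bigr => nu _; rewrite big_ord_recl fcons0.
by congr (_ * _); apply: eq_bigr => i _; rewrite fconsS.
Qed.

(** ** Truncation by weight *)

(** Kato's series is an infinite sum over the orders of perturbation, only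
    finitely many of which matter for a given coefficient: identities are first
    proved for partial sums, up to the weight [M]. *)
Definition eqmod (M : nat) f g := forall b, (weight b <= M)%N -> f b = g b.

Lemma eqmod_refl M f : eqmod M f f. Proof. by []. Qed.

Lemma eqmod_sym M f g : eqmod M f g -> eqmod M g f.
Proof. by move=> fg b /fg. Qed.

Lemma eqmod_trans M f g h : eqmod M f g -> eqmod M g h -> eqmod M f h.
Proof. by move=> fg gh b bM; rewrite fg ?gh. Qed.

Lemma eqmodB M f f' g g' : eqmod M f f' -> eqmod M g g' ->
  eqmod M (f - g) (f' - g').
Proof. by move=> ff gg b bM; rewrite !fcoefB ff ?gg. Qed.

Lemma eqmodM M f f' g g' : eqmod M f f' -> eqmod M g g' ->
  eqmod M (f * g) (f' * g').
Proof.
move=> ff gg b bM; rewrite !fcoefM !big_seq; apply: eq_bigr => -[n m] /=.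
rewrite mem_splits => /eqP /= bE; rewrite -bE weightD in bM.
rewrite ff ?gg //; first exact: leq_trans (leq_addl _ _) bM.
exact: leq_trans (leq_addr _ _) bM.
Qed.

Definition vanish (k : nat) f := forall b, (weight b < k)%N -> f b = 0.

Lemma vanishM j k f g : vanish j f -> vanish k g -> vanish (j + k) (f * g).
Proof.
move=> fj gk b bjk; rewrite fcoefM big_seq big1 // => -[n m] /=.
rewrite mem_splits => /eqP /= bE; rewrite -bE weightD in bjk.
have [nj|jn] := ltnP (weight n) j; first by rewrite fj ?mul0r.
rewrite gk ?mulr0 // -(ltn_add2l j); apply: leq_ltn_trans bjk.
by rewrite leq_add2r.
Qed.

Lemma vanish_exp k f p : vanish k f -> vanish (p * k) (f ^+ p).
Proof.
by move=> fk; elim: p => [|p IH] //; rewrite exprS mulSn; apply: vanishM.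
Qed.

End SeriesRing.
Arguments fconst {I T} t : simpl never.
Arguments fconv {I T} f g : simpl never.

(** * The perturbed resolvent as a formal series *)

Section Neumann.
Variables (L : pzRingType) (D G E z : L).
Hypotheses (DG : D * G = z) (GD : G * D = z).
Hypotheses (zG : GRing.comm z G) (zE : GRing.comm z E).

(** [z ^+ M.+1] times the partial sum of order [M] of the Neumann series
    [\sum_p (-1) ^+ p * R * (E * R) ^+ p] of the inverse of [D + E], where
    [R = G / z] stands for the inverse of [D]. *)
Fixpoint neumann M : L :=
  if M is M'.+1 then z * neumann M' + (-1) ^+ M * (G * (E * G) ^+ M) else G.

Let comm_sign x p : GRing.comm x ((-1) ^+ p : L).
Proof. exact/commrX/commrN1. Qed.

(** The sum telescopes: [D * G = z] turns the term of order [p] into the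
    opposite of what [E] makes of the term of order [p - 1]. *)
Lemma mul_neumann M :
  (D + E) * neumann M = z ^+ M.+1 + (-1) ^+ M * (E * G) ^+ M.+1.
Proof.
elim: M => [|M IH] /=; first by rewrite mulrDl DG !expr1 mul1r.
have zDE : (D + E) * z = z * (D + E).
  by rewrite mulrDl mulrDr -zE -{1}GD mulrA DG.
rewrite mulrDr mulrA zDE -mulrA IH mulrDr -exprS -addrA; congr (_ + _).
set X := (E * G) ^+ M.+1; set sg := (-1) ^+ M.+1.
have -> : (D + E) * (sg * (G * X)) = sg * (z * X) + sg * (E * G * X).
  rewrite mulrA comm_sign -mulrA -mulrDr; congr (_ * _).
  by rewrite mulrA mulrDl DG mulrDl.
rewrite -exprS addrA -[RHS]add0r; congr (_ + _).
by rewrite mulrA comm_sign -mulrA /sg exprS mulN1r mulNr subrr.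
Qed.

Lemma exp_swap M : (G * E) ^+ M * G = G * (E * G) ^+ M.
Proof.
elim: M => [|M IH]; first by rewrite mul1r mulr1.
by rewrite !exprS -mulrA IH !mulrA.
Qed.

Lemma neumann_mul M :
  neumann M * (D + E) = z ^+ M.+1 + (-1) ^+ M * (G * E) ^+ M.+1.
Proof.
elim: M => [|M IH] /=; first by rewrite mulrDr GD !expr1 mul1r.
rewrite mulrDl -mulrA IH mulrDr -exprS -addrA; congr (_ + _).
rewrite -exp_swap; set X := (G * E) ^+ M.+1; set sg := (-1) ^+ M.+1.
have -> : sg * (X * G) * (D + E) = sg * (X * z) + sg * (X * (G * E)).
  by rewrite -mulrDr -mulrDr -(mulrA sg) -(mulrA X) (mulrDr G) GD.
rewrite -exprSr addrA -[RHS]add0r; congr (_ + _).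
have <- : z * X = X * z by apply/commrX/commrM.
by rewrite mulrA comm_sign -mulrA /sg exprS mulN1r mulNr subrr.
Qed.

End Neumann.

Section Resolvent.
Variables (I : exponentType) (T : pzRingType).
Let K := fseries I T.
Let L := fseries nat K.

(** The spectral variable, measured from the unperturbed eigenvalue. *)
Definition zeta : L := Series (fun n => (n == 1%N)%:R).

Lemma coef_zetaM (f : L) n :
  (zeta * f) n = if n is m.+1 then f m else 0.
Proof.
rewrite fcoefM; case: n => [|n].
  rewrite big_seq big1 // => -[n m]; rewrite mem_splits /= => /eqP.
  by case: n => // _; rewrite mul0r.
have s1 : (1%N, n) \in splits n.+1 by rewrite mem_splits.
rewrite (bigD1_seq (1%N, n)) ?splits_uniq //= mul1r.
rewrite big_seq_cond big1 ?addr0 // => -[i j] /=; rewrite mem_splits /=.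
rewrite /zeta; case: (i =P 1%N) => [->|]; last by rewrite mul0r.
by case/andP => /eqP /(@addnI 1 j n) ->; rewrite eqxx.
Qed.

Lemma comm_zeta (f : L) : GRing.comm zeta f.
Proof.
apply: fseriesP => b; rewrite !fcoefM (splits_swap (fun n m => zeta n * f m)).
apply: eq_bigr => n _ /=.
by case: (_ =P 1%N); rewrite ?mul1r ?mulr1 ?mul0r ?mulr0.
Qed.

Lemma coef_zetaX k n : (zeta ^+ k) n = (n == k)%:R.
Proof.
elim: k n => [|k IH] n.
  by rewrite expr0 fcoef1; case: eqP.
by rewrite exprS coef_zetaM; case: n.
Qed.

End Resolvent.
Arguments zeta {I T}.

Section KatoSeries.
Variables (I : exponentType) (T : pzRingType).
Let K := fseries I T.
Let L := fseries nat K.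
(** [D] is the unperturbed operator minus its eigenvalue, with null projector
    [P0] and reduced resolvent [S0], and [E] is the perturbation. *)
Variables (D P0 S0 : T) (E : K).
Hypotheses (DP : D * P0 = 0) (PD : P0 * D = 0).
Hypotheses (SP : S0 * P0 = 0) (PS : P0 * S0 = 0).
Hypotheses (DS : D * S0 = 1 - P0) (SD : S0 * D = 1 - P0).
Hypothesis (E0 : vanish 1 E).

Definition spow (t : nat) : T := if t is 0%N then - P0 else S0 ^+ t.

(** [zeta] times the Laurent series of the inverse of [D - zeta]: the
    projector is the opposite of its residue at the simple pole [zeta = 0],
    and [S0] its value there once the pole is removed. *)
Definition free_resolvent : L := Series (fun t => fconst (spow t)).

(** The part of order [p] of the Neumann series, times [zeta ^+ p.+1]. *)
Definition kato_order (p : nat) : L :=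
  free_resolvent * (fconst E * free_resolvent) ^+ p.

(** The residue of the perturbed resolvent, with opposite sign. *)
Definition kato_series : K := Series (fun b =>
  - \sum_(p < (weight b).+1) (-1) ^+ p * kato_order p p b).

Local Notation B := (fconst D + E).
Local Notation G := free_resolvent.

Let DG : (fconst (fconst D) - zeta) * G = zeta.
Proof.
apply: fseriesP => n; rewrite mulrBl fcoefB coef_zetaM fcoef_constM /=.
rewrite -rmorphM.
case: n => [|[|n]]; rewrite /zeta /=.
- by rewrite mulrN DP oppr0 rmorph0 subr0.
- by rewrite -rmorphB expr1 DS opprK subrK rmorph1.
- rewrite -rmorphB exprS mulrA DS mulrBl mul1r exprS (mulrA P0) PS mul0r subr0.
  by rewrite -exprS subrr rmorph0.
Qed.

Let GD : G * (fconst (fconst D) - zeta) = zeta.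
Proof.
apply: fseriesP => n; rewrite mulrBr -comm_zeta fcoefB coef_zetaM fcoefM_const.
rewrite /= -rmorphM; case: n => [|[|n]]; rewrite /zeta /=.
- by rewrite mulNr PD oppr0 rmorph0 subr0.
- by rewrite -rmorphB expr1 SD opprK subrK rmorph1.
- rewrite -rmorphB exprSr -mulrA SD mulrBr mulr1 exprSr -(mulrA _ S0) SP mulr0.
  by rewrite subr0 -exprSr subrr rmorph0.
Qed.

(** Up to the weight [M], the coefficient of [zeta ^+ j] in [U M] is that of
    [zeta ^ (j - M - 1)] in the perturbed resolvent, whose pole has order at
    most [M + 1]. *)
Let U M : L := neumann G (fconst E) zeta M.

Let coefUM M j : (U M) j = \sum_(p < M.+1) (-1) ^+ p *
   (if (M - p <= j)%N then kato_order p (j - (M - p))%N else 0).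
Proof.
elim: M j => [|M IH] j.
  by rewrite big_ord1 mul1r subnn subn0 /kato_order expr0 mulr1.
have -> : U M.+1 = zeta * U M + (-1) ^+ M.+1 * kato_order M.+1 by [].
rewrite big_ord_recr fcoefD fcoef_signM subnn subn0; congr (_ + _).
rewrite coef_zetaM; case: j => [|j].
  rewrite big1 // => p _ /=; case: ifP; rewrite ?mulr0 // leqn0 subn_eq0.
  by rewrite leqNgt ltn_ord.
rewrite IH; apply: eq_bigr => p _.
by rewrite /= (subSn (_ : p <= M)%N) ?ltnS ?subSS // -ltnS.
Qed.

Let vanish_order j k (X Y : L) : (forall n, vanish j (X n)) ->
  (forall n, vanish k (Y n)) -> forall n, vanish (j + k) ((X * Y : L) n).
Proof.
move=> Xj Yk n b lt_b; rewrite fcoefM fcoef_sum big1 // => m _.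
exact: (vanishM (Xj _) (Yk _) lt_b).
Qed.

Let vanish_EG p n : vanish p (((fconst E * G) ^+ p : L) n).
Proof.
elim: p n => [|p IH] n //; rewrite exprS -add1n; apply: vanish_order => // m.
by rewrite fcoef_constM -[1%N]addn0; apply: vanishM.
Qed.

Let vanish_GE p n : vanish p (((G * fconst E) ^+ p : L) n).
Proof.
elim: p n => [|p IH] n //; rewrite exprS -add1n; apply: vanish_order => // m.
by rewrite fcoefM_const -[1%N]add0n; apply: vanishM.
Qed.

Lemma vanish_kato_order p n : vanish p (kato_order p n).
Proof. by rewrite -[p in vanish p]add0n; apply: vanish_order. Qed.

Let kato_seriesE M : eqmod M kato_series (- U M M).
Proof.
move=> b bM; rewrite fcoefN coefUM fcoef_sum; congr (- _).
rewrite (big_ord_widen M.+1 (fun p => (-1) ^+ p * kato_order p p b)) //.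
rewrite big_mkcond; apply: eq_bigr => p _.
rewrite leq_subr subKn -1?ltnS // fcoef_signM ltnS; case: leqP => // lt_bp.
by rewrite vanish_kato_order ?mulr0.
Qed.

(** Comparing coefficients in [(B - zeta) * U M = zeta ^+ M.+1], which holds up
    to the weight [M]. *)
Let Uleft M j : eqmod M (B * U M j)
  ((if j is i.+1 then U M i else 0) + (j == M.+1)%:R).
Proof.
move=> b bM; have := congr1 (fun f : L => f j b) (mul_neumann DG GD
  (comm_zeta (fconst E : L)) M).
rewrite [fconst (fconst D) - _ + _]addrAC -rmorphD mulrBl fcoefB.
rewrite fcoef_constM coef_zetaM.
rewrite !fcoefD fcoef_signM fcoef_signM vanish_EG //.
rewrite mulr0 addr0 coef_zetaX => /(canRL (subrK _)) ->; exact: addrC.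
Qed.

Let Uright M j : eqmod M (U M j * B)
  ((if j is i.+1 then U M i else 0) + (j == M.+1)%:R).
Proof.
move=> b bM; have := congr1 (fun f : L => f j b) (neumann_mul GD
  (comm_zeta G) (comm_zeta (fconst E : L)) M).
rewrite [fconst (fconst D) - _ + _]addrAC -rmorphD mulrBr -comm_zeta fcoefB.
rewrite fcoefM_const coef_zetaM.
rewrite !fcoefD fcoef_signM fcoef_signM vanish_GE //.
rewrite mulr0 addr0 coef_zetaX => /(canRL (subrK _)) ->; exact: addrC.
Qed.

(** Writing [R_n] for the coefficient of [zeta ^ n] in the resolvent, [R_n] is
    [B] times [R_(n + 1)] except for [n = -1]; hence
    [R_0 R_(-2) = R_1 R_(-3) = R_2 R_(-4)], and so on until the pole order is
    exceeded. *)
Let U_mul_vanish M k j : (j <= M)%N ->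
  eqmod M (U M (M.+1 + k)%N * (B * U M j)) 0.
Proof.
elim: j k => [|j IH] k jM.
  rewrite -[0](mulr0 (U M (M.+1 + k)%N)); apply: eqmodM; first exact: eqmod_refl.
  by have := @Uleft M 0%N; rewrite addr0.
apply: (eqmod_trans (g := U M (M.+1 + k.+1)%N * B * U M j)).
  apply: eqmodM.
    have := @Uright M (M.+1 + k.+1)%N.
    rewrite addnS gtn_eqF ?addr0; first exact: eqmod_sym.
    by rewrite ltnS leq_addr.
  have := @Uleft M j.+1; rewrite ltn_eqF ?addr0 ?ltnS //.
by rewrite -mulrA; apply: IH; apply: ltnW.
Qed.

Let residueE M : eqmod M (U M M) (B * U M M.+1 - 1) /\
  eqmod M (U M M) (U M M.+1 * B - 1).
Proof.
split=> b bM; rewrite fcoefB.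
  by rewrite (@Uleft M M.+1 b bM) eqxx fcoefD addrK.
by rewrite (@Uright M M.+1 b bM) eqxx fcoefD addrK.
Qed.

(** The residue is [R_(-1) = R_0 B - 1], so that
    [R_(-1) R_(-1) = R_0 R_(-2) - R_(-1) = - R_(-1)]. *)
Lemma kato_series_idem : kato_series * kato_series = kato_series.
Proof.
apply: fseriesP => b; pose M := weight b.
suff QQ : eqmod M (U M M * U M M) (- U M M).
  have PQ := @kato_seriesE M.
  by rewrite (eqmodM PQ PQ) // [RHS]PQ // mulrNN; exact: QQ.
apply: (eqmod_trans (g := (U M M.+1 * B - 1) * U M M)).
  by apply: eqmodM; [exact: (residueE M).2 | exact: eqmod_refl].
rewrite mulrBl mul1r -mulrA -[X in eqmod _ _ X]add0r.
apply: eqmodB; last exact: eqmod_refl.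
by have := @U_mul_vanish M 0 M (leqnn M); rewrite addn0.
Qed.

(** [B R_0 = R_(-1) + 1 = R_0 B] gives [R_(-1) B = B R_0 B - B = B R_(-1)]. *)
Lemma kato_series_comm : B * kato_series = kato_series * B.
Proof.
apply: fseriesP => b; pose M := weight b.
have rB : eqmod M B B by [].
suff QB : eqmod M (B * U M M) (U M M * B).
  rewrite (eqmodM rB (@kato_seriesE M)) //.
  rewrite (eqmodM (@kato_seriesE M) rB) // mulrN mulNr.
  by rewrite !fcoefN QB.
apply: eqmod_trans (eqmodM rB (residueE M).2) _.
apply: eqmod_trans (eqmod_sym (eqmodM (residueE M).1 rB)).
by rewrite mulrBr mulrBl mulr1 mul1r mulrA; apply: eqmod_refl.
Qed.

Lemma kato_series0 : kato_series 0 = P0.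
Proof.
have w0 : weight (0 : I) = 0%N by apply/eqP; rewrite weight_eq0.
rewrite [LHS]/(- _) w0 big_ord1 expr0 mul1r /kato_order expr0 mulr1.
rewrite fcoef_const eqxx; exact: opprK.
Qed.

End KatoSeries.

(** * Adjoints of formal series *)

Definition antimorphism (S T : pzRingType) (sg : S -> T) :=
  [/\ forall s t, sg (s + t) = sg s + sg t, sg 1 = 1 &
      forall s t, sg (s * t) = sg t * sg s].

Definition fmap (I S T : Type) (sg : S -> T) (f : fseries I S) : fseries I T :=
  Series (fun b => sg (f b)).

Lemma fcoef_fmap (I S T : Type) (sg : S -> T) (f : fseries I S) b :
  fmap sg f b = sg (f b).
Proof. by []. Qed.

Section Antimorphism.
Variables (S T : pzRingType) (sg : S -> T).
Hypothesis sgP : antimorphism sg.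

Lemma antimorphismD s t : sg (s + t) = sg s + sg t. Proof. by case: sgP. Qed.
Lemma antimorphism1 : sg 1 = 1. Proof. by case: sgP. Qed.
Lemma antimorphismM s t : sg (s * t) = sg t * sg s. Proof. by case: sgP. Qed.
Lemma antimorphism0 : sg 0 = 0.
Proof. by apply: (addrI (sg 0)); rewrite -antimorphismD !addr0. Qed.
Lemma antimorphismN s : sg (- s) = - sg s.
Proof. by apply: (addrI (sg s)); rewrite -antimorphismD !subrr antimorphism0. Qed.
Lemma antimorphismX s p : sg (s ^+ p) = sg s ^+ p.
Proof.
elim: p => [|p IH]; first exact: antimorphism1.
by rewrite exprS exprSr antimorphismM IH.
Qed.
Lemma antimorphism_sum (J : Type) (r : seq J) (Q : pred J) (F : J -> S) :
  sg (\sum_(j <- r | Q j) F j) = \sum_(j <- r | Q j) sg (F j).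
Proof. exact: (big_morph sg antimorphismD antimorphism0). Qed.

Lemma antimorphism_fmap (I : exponentType) :
  antimorphism (fmap sg : fseries I S -> fseries I T).
Proof.
split=> [f g||f g]; apply: fseriesP => b.
- exact: antimorphismD.
- by rewrite fcoef_fmap !fcoef1; case: ifP; rewrite ?antimorphism1 ?antimorphism0.
rewrite fcoef_fmap !fcoefM antimorphism_sum.
rewrite (splits_swap (fun n m => sg (g n) * sg (f m))).
by apply: eq_bigr => n _; rewrite antimorphismM.
Qed.

Lemma fmap_fconst (I : exponentType) s :
  fmap sg (fconst s : fseries I S) = fconst (sg s).
Proof.
apply: fseriesP => b; rewrite fcoef_fmap !fcoef_const.
by case: ifP; rewrite ?antimorphism0.
Qed.
End Antimorphism.

Section KatoAdjoint.
Variables (I : exponentType) (T : pzRingType) (P0 S0 : T) (E : fseries I T).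
Variable sg : T -> T.
Hypotheses (sgP : antimorphism sg) (sgP0 : sg P0 = P0) (sgS0 : sg S0 = S0).
Hypothesis sgE : forall b, sg (E b) = E b.

(** All factors are self-adjoint, and reversing their order permutes the terms
    of a given order. *)
Lemma kato_series_adjoint b :
  sg (kato_series P0 S0 E b) = kato_series P0 S0 E b.
Proof.
pose sg1 := fmap (I := I) sg; have sg1P : antimorphism sg1.
  exact: antimorphism_fmap.
pose sg2 := fmap (I := nat) sg1; have sg2P : antimorphism sg2.
  exact: antimorphism_fmap.
have sgG : sg2 (free_resolvent I P0 S0) = free_resolvent I P0 S0.
  apply: fseriesP => t; rewrite fcoef_fmap [LHS]fmap_fconst //=.
  congr fconst; case: t => [|t]; first by rewrite antimorphismN ?sgP0.
  by rewrite antimorphismX ?sgS0.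
have sgE2 : sg2 (fconst E) = fconst E.
  by rewrite /sg2 fmap_fconst //; congr fconst; apply: fseriesP => a /=.
have sgK p : sg2 (kato_order P0 S0 E p) = kato_order P0 S0 E p.
  by rewrite /kato_order -[RHS]exp_swap (antimorphismM sg2P)
    (antimorphismX sg2P) (antimorphismM sg2P) sgG sgE2.
rewrite (antimorphismN sgP) (antimorphism_sum sgP); congr (- _).
apply: eq_bigr => p _; rewrite (antimorphismM sgP) (antimorphismX sgP).
rewrite (antimorphismN sgP) (antimorphism1 sgP).
have -> : sg (kato_order P0 S0 E p p b) = sg2 (kato_order P0 S0 E p) p b by [].
by rewrite sgK; apply/commrX/commrN1.
Qed.
End KatoAdjoint.

(** * Kato's formula *)

Lemma prod_ord_eq0 (T : pzRingType) p (F : 'I_p -> T) i :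
  F i = 0 -> \prod_j F j = 0.
Proof.
elim: p F i => [|p IH] F i; first by case: i.
rewrite big_ord_recl; case: (unliftP ord0 i) => [j|] -> Fi; last first.
  by rewrite Fi mul0r.
by rewrite (IH (fun j => F (lift ord0 j)) j Fi) mulr0.
Qed.

Section KatoExpansion.
Variables (I : exponentType) (T : pzRingType) (P0 S0 : T) (E : fseries I T).

Lemma kato_orderE p m b : kato_order P0 S0 E p m b =
  \sum_(nu <- comps p b) \sum_(k <- comps p.+1 m)
    (\prod_(i < p) (spow P0 S0 (k (widen_ord (leqnSn p) i)) * E (nu i))) *
    spow P0 S0 (k ord_max).
Proof.
pose G := free_resolvent I P0 S0.
pose F (i : 'I_p.+1) := if (i < p)%N then G * fconst E else G.
have -> : kato_order P0 S0 E p = \prod_i F i.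
  rewrite /kato_order -exp_swap big_ord_recr /= {2}/F ltnn; congr (_ * _).
  rewrite (eq_bigr (fun=> G * fconst E)) ?prodr_const ?card_ord // => i _.
  by rewrite /F /= ltn_ord.
rewrite fcoef_prod fcoef_sum exchange_big; apply: eq_bigr => k _.
rewrite big_ord_recr {2}/F ltnn fcoefM_const fcoef_prod mulr_suml.
apply: eq_bigr => nu _; congr (_ * _); apply: eq_bigr => i _.
by rewrite /F /= ltn_ord fcoefM_const fcoef_constM.
Qed.
End KatoExpansion.

Section KatoCoef.
Variables (R : realType) (N d : nat).
Local Notation M := 'M[R[i]]_N.
Variables (P0 S0 : M) (Ac : fseries (multiindex d) M).

(** As [Ac - fconst (Ac 0)] has no constant term, the compositions of [b] with
    a zero part contribute nothing to the right-hand side. *)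
Lemma sum_kato_indices b p :
  \sum_(nk \in @kato_indices d b p) kato_term P0 S0 Ac nk =
  kato_order P0 S0 (Ac - fconst (Ac 0)) p p b.
Proof.
pose r := [seq nk : {ffun 'I_p -> multiindex d} * {ffun 'I_p.+1 -> nat}
  <- [seq (nu, k) | nu <- comps p b, k <- comps p.+1 p]
  | [forall i, nk.1 i != 0]].
have Ur : uniq r.
  by rewrite filter_uniq // allpairs_uniq ?comps_uniq // => -[? ?] [? ?].
have -> : @kato_indices d b p = [set` r].
  apply/seteqP; split=> -[nu k] /=.
    case=> /= nu0 nub kp; rewrite mem_filter; apply/andP; split.
      exact/forallP.
    apply/allpairsP; exists (nu, k); rewrite !mem_comps nub eqxx.
    by split=> //; apply/eqP.
  rewrite mem_filter => /andP[/forallP nu0 /allpairsP[[nu' k'] /=]].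
  rewrite !mem_comps => -[/eqP nub /eqP kp [e1 e2]].
  by rewrite -e1 -e2 in nub kp; split.
rewrite -fsbig_seq // big_filter big_mkcond big_allpairs_dep kato_orderE.
apply: eq_bigr => nu _; apply: eq_bigr => k _ /=.
have [i /eqP nui|nu0] := pickP (fun i => nu i == 0); last first.
  rewrite (introT forallP) => [|i]; last by rewrite nu0.
  rewrite /kato_term; congr (_ * _); apply: eq_bigr => i _.
  by rewrite nu0 subr0.
rewrite (introF forallP) => [|/(_ i)]; last by rewrite nui eqxx.
rewrite (prod_ord_eq0 (i := i)) ?mul0r //.
by rewrite nui eqxx subrr mulr0.
Qed.

Lemma kato_coefE b : b != 0 ->
  kato_coef P0 S0 Ac b = kato_series P0 S0 (Ac - fconst (Ac 0)) b.
Proof.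
move=> b0; congr (- _); rewrite -(big_mkord xpredT (fun p => (-1) ^+ p *
  kato_order P0 S0 (Ac - fconst (Ac 0)) p p b)) big_nat_recl //.
rewrite expr0 mul1r /kato_order expr0 mulr1 fcoef_const (negPf b0) add0r.
rewrite big_add1; apply: eq_bigr => p _; rewrite sum_kato_indices.
rewrite -signr_odd -[in RHS]signr_odd; case: odd.
  by rewrite expr1 scaleN1r mulN1r.
by rewrite scale1r mul1r.
Qed.

End KatoCoef.

(** * Coefficients of an idempotent series *)

Section IdempotentRank.
Variables (I : exponentType) (F : fieldType) (N : nat).
Variables (P : fseries I 'M[F]_N) (P0 : 'M[F]_N).
Hypotheses (PP : P * P = P) (P00 : P 0 = P0) (PP0 : P0 * P0 = P0).

(** Over the formal series, [P] is equivalent to its constant term: the series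
    [W = P P0 + (1 - P) (1 - P0)] satisfies [P W = P P0] and has constant
    term [1], hence has a right inverse [V] modulo any weight.  So
    [P = P P0 V], and each of the products contributing to a coefficient of
    the right-hand side goes through [P0]. *)
Lemma rank_idempotent_coef b : (\rank (P b) <= \rank P0 * size (splits b))%N.
Proof.
pose C : fseries I 'M[F]_N := fconst P0.
pose W := P * C + (1 - P) * (1 - C).
have PW : P * W = P * C.
  have P1P : P * (1 - P) = 0 by rewrite mulrBr mulr1 PP subrr.
  by rewrite /W mulrDr !mulrA PP P1P mul0r addr0.
have W1 : vanish 1 (W - 1).
  move=> a; rewrite ltnS leqn0 weight_eq0 => /eqP ->.
  rewrite /W fcoefB fcoefD mulrBr mulr1 fcoefB !fcoefM_const fcoefB P00 fcoef1.
  rewrite eqxx PP0; have -> : (1 - P0) * P0 = 0 by rewrite mulrBl mul1r PP0 subrr.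
  by rewrite subr0 [P0 + _]addrC subrK subrr.
pose n := (weight b).+1.
pose V := \sum_(i < n) (1 - W) ^+ i.
have PE : P b = (P * C * V) b.
  have WV : W * V = 1 - (1 - W) ^+ n.
    have := subrX1 (1 - W) n; rewrite addrAC subrr sub0r mulNr => /eqP.
    by rewrite eq_sym eqr_oppLR opprB => /eqP.
  rewrite -PW -mulrA WV mulrBr mulr1 fcoefB.
  have K1 : vanish 1 (1 - W) by move=> a a1; rewrite -opprB fcoefN W1 ?oppr0.
  rewrite (vanishM (j := 0) _ (vanish_exp (p := n) K1)) ?subr0 //.
  by rewrite add0n muln1.
rewrite PE fcoefM; elim: (splits b) => [|m s IH]; first by rewrite big_nil mxrank0.
rewrite big_cons mulnS; apply: leq_trans (mxrank_add _ _) (leq_add _ IH).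
rewrite fcoefM_const; apply: leq_trans (mxrankM_maxl _ _) _.
exact: mxrankM_maxr.
Qed.
End IdempotentRank.

Section BlockRecursion.
Variables (I : exponentType) (T : pzRingType) (sg : T -> T).
Variables (A P : fseries I T) (P0 S0 : T) (lam : T).
Hypotheses (sgP : antimorphism sg) (PA : P * A = A * P) (PP : P * P = P).
Hypothesis PP0 : P0 * P0 = P0.
Hypotheses (sgP0 : sg P0 = P0) (sgPb : forall b, sg (P b) = P b).
Hypotheses (lamC : forall t, lam * t = t * lam).
Hypotheses (DP : (A 0 - lam) * P0 = 0) (SD : S0 * (A 0 - lam) = 1 - P0).
Let Z := (P - fconst P0) * (P - fconst P0).
Let W := (A - fconst (A 0)) * P - P * (A - fconst (A 0)).

(** The coefficients of [P * P = P] give the diagonal blocks of [P b] with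
    respect to [P0], and those of [A * P = P * A] the off-diagonal ones. *)
Lemma idempotent_recursion b : b != 0 ->
  P b = - (P0 * Z b * P0) + (1 - P0) * Z b * (1 - P0)
        - S0 * W b * P0 - sg (S0 * W b * P0).
Proof.
move=> b0; set X := P b.
have ZE : Z b = X - P0 * X - X * P0.
  rewrite /Z mulrBr !mulrBl PP !fcoefB fcoef_constM fcoefM_const.
  rewrite fcoefM_const fcoef_const (negPf b0) mul0r subr0.
  by rewrite -/X.
have WE : W b = X * A 0 - A 0 * X.
  rewrite /W mulrBr mulrBl PA [LHS]fcoefB !fcoefB fcoef_constM fcoefM_const -/X.
  by rewrite opprB addrC addrA subrK.
have SW : S0 * W b * P0 = - ((1 - P0) * X * P0).
  have AP : A 0 * P0 = lam * P0 by apply/eqP; rewrite -subr_eq0 -mulrBl DP.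
  rewrite WE -SD [X in X * P0]mulrBr [LHS]mulrBl [in RHS]mulrBr !mulrBl opprB.
  congr (_ - _); last by rewrite mulrA.
  by rewrite -mulrA -mulrA AP [X * _]mulrA -lamC !mulrA.
have q0 : (1 - P0) * P0 = 0 by rewrite mulrBl mul1r PP0 subrr.
have SW' : sg (S0 * W b * P0) = - (P0 * X * (1 - P0)).
  rewrite SW (antimorphismN sgP) !(antimorphismM sgP) (antimorphismD sgP).
  by rewrite (antimorphism1 sgP) (antimorphismN sgP) sgP0 sgPb -/X mulrA.
rewrite SW' SW ZE.
have -> : P0 * (X - P0 * X - X * P0) * P0 = - (P0 * X * P0).
  rewrite !mulrBr !mulrBl !mulrA PP0 -!mulrA PP0.
  by rewrite subrr sub0r.
have -> : (1 - P0) * (X - P0 * X - X * P0) * (1 - P0) = (1 - P0) * X * (1 - P0).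
  have q0' : P0 * (1 - P0) = 0 by rewrite mulrBr mulr1 PP0 subrr.
  have -> : (1 - P0) * (X - P0 * X - X * P0) = (1 - P0) * X - (1 - P0) * X * P0.
    by rewrite !(mulrBr (1 - P0)) !mulrA q0 mul0r subr0.
  by rewrite (mulrBl (1 - P0)) -(mulrA _ P0) q0' mulr0 subr0.
rewrite !opprK -(addrA (P0 * X * P0)) -mulrDr subrK mulr1 addrAC -mulrDr.
by rewrite [P0 + _]addrC subrK mulr1 -mulrDl [P0 + _]addrC subrK mul1r.
Qed.
End BlockRecursion.

(** * A submultiplicative norm on complex matrices *)

Section ComplexNorm.
Variable R : realType.
Implicit Types z w : R[i].

(** Equivalent to the modulus, but free of square roots and real-valued. *)
Definition abs1 z : R := `|complex.Re z| + `|complex.Im z|.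

Lemma abs1_ge0 z : 0 <= abs1 z.
Proof. by rewrite addr_ge0. Qed.

Lemma abs10 : abs1 0 = 0.
Proof. by rewrite /abs1 !normr0 addr0. Qed.

Lemma abs1_eq0 z : abs1 z = 0 -> z = 0.
Proof.
case: z => x y /eqP; rewrite paddr_eq0 //= !normr_eq0.
by case/andP => /eqP -> /eqP ->.
Qed.

Lemma abs1N z : abs1 (- z) = abs1 z.
Proof. by case: z => x y; rewrite /abs1 /= !normrN. Qed.

Lemma abs1_conj z : abs1 z^* = abs1 z.
Proof. by case: z => x y; rewrite /abs1 /= normrN. Qed.

Lemma ler_abs1D z w : abs1 (z + w) <= abs1 z + abs1 w.
Proof.
case: z w => x y [u v]; rewrite /abs1 /= addrACA.
by apply: lerD; apply: ler_normD.
Qed.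

Lemma ler_abs1M z w : abs1 (z * w) <= abs1 z * abs1 w.
Proof.
case: z w => x y [u v]; rewrite /abs1 /= mulrDl !mulrDr -!normrM.
have := ler_normB (x * u) (y * v); have := ler_normD (x * v) (y * u).
lra.
Qed.

Lemma abs1Z (x : R) z : abs1 (x%:C%C * z) = `|x| * abs1 z.
Proof.
case: z => u v; rewrite /abs1 /= !mul0r subr0 addr0.
by rewrite !normrM mulrDr.
Qed.

Lemma ler_norm_abs1 z : `|z| <= (abs1 z)%:C%C.
Proof.
rewrite [z in `|z|]complexE; apply: le_trans (ler_normD _ _) _.
rewrite normrM rmorphD; apply: lerD.
  by rewrite normc_def /= expr0n addr0 sqrtr_sqr.
rewrite !normc_def /= expr0n !expr1n add0r sqrtr1 mul1r.
by rewrite addr0 sqrtr_sqr.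
Qed.

Lemma ler_abs1_norm z : (abs1 z)%:C%C <= `|z| *+ 2.
Proof.
rewrite normc_def -rmorphMn lecR mulr2n /abs1; case: z => x y /=.
by apply: lerD; rewrite -sqrtr_sqr ler_sqrt ?addr_ge0 ?sqr_ge0 //
  ?lerDl ?lerDr sqr_ge0.
Qed.

End ComplexNorm.

Section MatrixNorm.
Variables (R : realType) (N : nat).
Implicit Types A B : 'M[R[i]]_N.

(** Unlike the maximum of the entries, the sum is submultiplicative. *)
Definition nrm A : R := \sum_i \sum_j abs1 (A i j).

Lemma nrm_ge0 A : 0 <= nrm A.
Proof. by apply: sumr_ge0 => i _; apply: sumr_ge0 => j _; apply: abs1_ge0. Qed.

Lemma ler_abs1_nrm A i j : abs1 (A i j) <= nrm A.
Proof.
rewrite /nrm (bigD1 i) //= (bigD1 j) //= -addrA lerDl addr_ge0 //.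
  by apply: sumr_ge0 => k _; apply: abs1_ge0.
by apply: sumr_ge0 => k _; apply: sumr_ge0 => l _; apply: abs1_ge0.
Qed.

Lemma nrm0 : nrm 0 = 0.
Proof. by rewrite /nrm big1 // => i _; rewrite big1 // => j _; rewrite mxE abs10. Qed.

Lemma nrm_eq0 A : nrm A = 0 -> A = 0.
Proof.
move=> A0; apply/matrixP => i j; rewrite mxE; apply: abs1_eq0.
by apply/le_anti; rewrite abs1_ge0 andbT -A0 ler_abs1_nrm.
Qed.

Lemma nrmN A : nrm (- A) = nrm A.
Proof. by apply: eq_bigr => i _; apply: eq_bigr => j _; rewrite mxE abs1N. Qed.

Lemma nrm_adjoint A : nrm (A^t*) = nrm A.
Proof.
rewrite /nrm exchange_big; apply: eq_bigr => i _; apply: eq_bigr => j _.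
by rewrite !mxE; apply: abs1_conj.
Qed.

Lemma ler_nrmD A B : nrm (A + B) <= nrm A + nrm B.
Proof.
rewrite -big_split; apply: ler_sum => i _; rewrite -big_split.
by apply: ler_sum => j _; rewrite mxE ler_abs1D.
Qed.

Lemma ler_nrmB A B : nrm (A - B) <= nrm A + nrm B.
Proof. by rewrite -(nrmN B) ler_nrmD. Qed.

Lemma ler_nrm_sum (J : Type) (s : seq J) (Q : pred J) (F : J -> 'M[R[i]]_N) :
  nrm (\sum_(j <- s | Q j) F j) <= \sum_(j <- s | Q j) nrm (F j).
Proof.
elim/big_rec2: _ => [|j x y _ IH]; first by rewrite nrm0.
by apply: le_trans (ler_nrmD _ _) _; rewrite lerD2l.
Qed.

Lemma ler_nrmM A B : nrm (A * B) <= nrm A * nrm B.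
Proof.
have abs1_sum (F : 'I_N -> R[i]) : abs1 (\sum_k F k) <= \sum_k abs1 (F k).
  elim/big_rec2: _ => [|j x y _ IH]; first by rewrite abs10.
  by apply: le_trans (ler_abs1D _ _) _; rewrite lerD2l.
rewrite /nrm mulr_suml; apply: ler_sum => i _; rewrite mulr_suml.
apply: (@le_trans _ _ (\sum_j \sum_k abs1 (A i k) * abs1 (B k j))).
  apply: ler_sum => j _; rewrite mxE; apply: le_trans (abs1_sum _) _.
  by apply: ler_sum => k _; apply: ler_abs1M.
rewrite exchange_big; apply: ler_sum => k _; rewrite -mulr_sumr.
apply: ler_wpM2l; rewrite ?abs1_ge0 // [leRHS](bigD1 k) //= lerDl.
by apply: sumr_ge0 => l _; apply: sumr_ge0 => j _; apply: abs1_ge0.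
Qed.

Lemma nrmZ (x : R) A : nrm (x%:C%C *: A) = `|x| * nrm A.
Proof.
rewrite /nrm mulr_sumr; apply: eq_bigr => i _; rewrite mulr_sumr.
by apply: eq_bigr => j _; rewrite mxE abs1Z.
Qed.

Lemma ler_nrmX A p : nrm (A ^+ p.+1) <= nrm A ^+ p.+1.
Proof.
elim: p => [|p IH] //; rewrite exprS [leRHS]exprS.
by apply: le_trans (ler_nrmM _ _) _; rewrite ler_wpM2l ?nrm_ge0.
Qed.

End MatrixNorm.

(** * Unconditional sums *)

Section UnconditionalSums.
Variables (R : realType) (N : nat).
Local Notation M := 'M[R[i]]_N.

(** Bounding the sums of norms over finite sets expresses absolute convergence
    by real inequalities alone, and [sums_to] is convergence of the net of
    finite partial sums, over duplicate-free sequences. *)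
Definition abs_bounded (I : eqType) (a : I -> M) (C : R) :=
  forall s, uniq s -> \sum_(b <- s) nrm (a b) <= C.

Definition sums_to (I : eqType) (a : I -> M) (L : M) :=
  forall e, 0 < e -> exists s0, uniq s0 /\
    forall s, uniq s -> {subset s0 <= s} -> nrm (\sum_(b <- s) a b - L) < e.

Lemma sub_uniq_sum (I : eqType) (u : I -> R) r s : (forall i, 0 <= u i) ->
  uniq r -> uniq s -> {subset r <= s} ->
  \sum_(b <- r) u b <= \sum_(b <- s) u b.
Proof.
move=> u0 Ur Us rs; rewrite [leRHS](bigID (mem r)) /=.
rewrite -[\sum_(b <- s | b \in r) _]big_filter.
rewrite (@eq_sum_uniq _ _ r [seq b <- s | b \in r]) ?filter_uniq //.
  by rewrite lerDl sumr_ge0.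
move=> b; rewrite mem_filter; case: (boolP (b \in r)) => //= br.
by rewrite rs.
Qed.

Section OneFamily.
Variable I : eqType.
Implicit Types (a : I -> M) (L : M).

Lemma abs_bounded_ge0 a C : abs_bounded a C -> 0 <= C.
Proof. by move=> /(_ [::] isT); rewrite big_nil. Qed.

Lemma abs_bounded_le a C D : abs_bounded a C -> C <= D -> abs_bounded a D.
Proof. by move=> aC CD s /aC /le_trans; apply. Qed.

Lemma abs_bounded_dom a a' C : (forall b, nrm (a b) <= nrm (a' b)) ->
  abs_bounded a' C -> abs_bounded a C.
Proof. by move=> aa a'C s /a'C; apply: le_trans; apply: ler_sum. Qed.

Lemma abs_boundedD a a' C D : abs_bounded a C -> abs_bounded a' D ->
  abs_bounded (fun b => a b + a' b) (C + D).
Proof.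
move=> aC aD s Us; apply: le_trans (lerD (aC s Us) (aD s Us)).
by rewrite -big_split; apply: ler_sum => b _; apply: ler_nrmD.
Qed.

Lemma abs_boundedN a C : abs_bounded a C -> abs_bounded (fun b => - a b) C.
Proof. by move=> aC s /aC; under [in X in _ -> X]eq_bigr do rewrite nrmN. Qed.

Lemma abs_bounded_sum (J : Type) (r : seq J) (F : J -> I -> M) (C : J -> R) :
  (forall j, abs_bounded (F j) (C j)) ->
  abs_bounded (fun b => \sum_(j <- r) F j b) (\sum_(j <- r) C j).
Proof.
move=> FC s Us; apply: (@le_trans _ _ (\sum_(b <- s) \sum_(j <- r) nrm (F j b))).
  by apply: ler_sum => b _; apply: ler_nrm_sum.
by rewrite exchange_big; apply: ler_sum => j _; apply: FC.
Qed.

(** Take a finite set on which the sum of the norms nearly attains its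
    supremum over all finite sets. *)
Lemma abs_bounded_tail a C : abs_bounded a C -> forall e, 0 < e ->
  exists s0, uniq s0 /\ forall s, uniq s -> (forall b, b \in s -> b \notin s0) ->
    \sum_(b <- s) nrm (a b) < e.
Proof.
move=> aC e e0; pose S := [set x | exists2 s, uniq s & x = \sum_(b <- s) nrm (a b)].
have supS : has_sup S.
  split; first by exists (\sum_(b <- [::]) nrm (a b)); exists [::].
  by exists C => _ [s Us ->]; apply: aC.
have [_ [s0 Us0 ->] s0e] := sup_adherent e0 supS.
exists s0; split=> // s Us ss0.
have : S (\sum_(b <- s0 ++ s) nrm (a b)).
  exists (s0 ++ s) => //; rewrite cat_uniq Us0 Us andbT /=.
  by apply/hasPn => b /ss0.
move=> /(sup_upper_bound supS); rewrite big_cat /=; lra.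
Qed.

Lemma sums_to_unique a L L' : sums_to a L -> sums_to a L' -> L = L'.
Proof.
move=> aL aL'; apply/eqP; rewrite -subr_eq0; apply/eqP/nrm_eq0/le_anti.
rewrite nrm_ge0 andbT; apply/ler_addgt0Pl => e e0.
have e20 : 0 < e / 2 by rewrite divr_gt0.
have [s [Us sP]] := aL _ e20; have [t [Ut tP]] := aL' _ e20.
have sU : {subset s <= undup (s ++ t)}.
  by move=> b bs; rewrite mem_undup mem_cat bs.
have tU : {subset t <= undup (s ++ t)}.
  by move=> b bt; rewrite mem_undup mem_cat bt orbT.
have := sP _ (undup_uniq _) sU; have := tP _ (undup_uniq _) tU.
set X := \sum_(b <- _) a b; have := ler_nrmB (X - L') (X - L).
rewrite opprB addrC addrA subrK; lra.
Qed.

Lemma sums_toD a a' L L' : sums_to a L -> sums_to a' L' ->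
  sums_to (fun b => a b + a' b) (L + L').
Proof.
move=> aL aL' e e0; have e20 : 0 < e / 2 by rewrite divr_gt0.
have [s [Us sP]] := aL _ e20; have [t [Ut tP]] := aL' _ e20.
exists (undup (s ++ t)); split=> [|u Uu stu]; first exact: undup_uniq.
have su : {subset s <= u}.
  by move=> b bs; apply: stu; rewrite mem_undup mem_cat bs.
have tu : {subset t <= u}.
  by move=> b bt; apply: stu; rewrite mem_undup mem_cat bt orbT.
rewrite big_split /= opprD addrACA.
apply: le_lt_trans (ler_nrmD _ _) _.
by have := sP _ Uu su; have := tP _ Uu tu; lra.
Qed.

Lemma sums_toN a L : sums_to a L -> sums_to (fun b => - a b) (- L).
Proof.
move=> aL e /aL[s [Us sP]]; exists s; split=> // t Ut /(sP _ Ut).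
by rewrite sumrN -opprD nrmN.
Qed.

Lemma sums_toB a a' L L' : sums_to a L -> sums_to a' L' ->
  sums_to (fun b => a b - a' b) (L - L').
Proof. by move=> aL aL'; apply: sums_toD aL (sums_toN aL'). Qed.

Lemma eq_sums_to a a' L : a =1 a' -> sums_to a L -> sums_to a' L.
Proof.
move=> aa aL e /aL[s [Us sP]]; exists s; split=> // t Ut /(sP _ Ut).
by rewrite (eq_bigr _ (fun b _ => aa b)).
Qed.

Lemma sums_to_sum (J : Type) (r : seq J) (F : J -> I -> M) (L : J -> M) :
  (forall j, sums_to (F j) (L j)) ->
  sums_to (fun b => \sum_(j <- r) F j b) (\sum_(j <- r) L j).
Proof.
move=> FL; elim: r => [|j r IH].
  move=> e e0; exists [::]; split=> // s _ _.
  by rewrite big1 ?big_nil ?subrr ?nrm0 // => b _; rewrite big_nil.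
rewrite big_cons; apply: eq_sums_to (sums_toD (FL j) IH).
by move=> b; rewrite big_cons.
Qed.

Lemma sums_to_adjoint a L : sums_to a L -> sums_to (fun b => (a b)^t*) (L^t*).
Proof.
move=> aL e /aL[s [Us sP]]; exists s; split=> // t Ut /(sP _ Ut).
rewrite -nrm_adjoint; congr (nrm _ < _).
rewrite linearB map_mxB; congr (_ - _).
by rewrite linear_sum /= raddf_sum.
Qed.

Lemma sums_to_real_nonneg (u : I -> R) C (X : M) : (forall b, 0 <= u b) ->
  (forall s, uniq s -> \sum_(b <- s) u b <= C) ->
  exists L, sums_to (fun b => (u b)%:C%C *: X) L.
Proof.
move=> u0 uC; pose S := [set x | exists2 s, uniq s & x = \sum_(b <- s) u b].
have supS : has_sup S.
  split; first by exists (\sum_(b <- [::]) u b); exists [::].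
  by exists C => _ [s Us ->]; apply: uC.
exists ((sup S)%:C%C *: X) => e e0.
have n0 : 0 < nrm X + 1 by rewrite ltr_wpDl ?nrm_ge0.
have [_ [s0 Us0 ->] s0e] := sup_adherent (divr_gt0 e0 n0) supS.
exists s0; split=> // s Us s0s.
rewrite -scaler_suml -scalerBl -rmorph_sum -rmorphB nrmZ.
have s0le : \sum_(b <- s0) u b <= \sum_(b <- s) u b by apply: sub_uniq_sum.
have sle : \sum_(b <- s) u b <= sup S by apply: sup_upper_bound => //; exists s.
rewrite distrC ger0_norm ?subr_ge0 //.
apply: (@le_lt_trans _ _ ((e / (nrm X + 1)) * nrm X)).
  by apply: ler_wpM2r; rewrite ?nrm_ge0 //; lra.
rewrite mulrAC ltr_pdivrMr // ltr_pM2l // ltrDl //.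
Qed.

(** Completeness: decompose into real and imaginary parts of the entries, and
    then into positive parts. *)
Lemma abs_bounded_sums a C : abs_bounded a C -> exists L, sums_to a L.
Proof.
move=> aC.
have real_sums (u : I -> R) X : (forall b, `|u b| <= nrm (a b)) ->
    exists L, sums_to (fun b => (u b)%:C%C *: X) L.
  move=> ua.
  have uC s : uniq s -> \sum_(b <- s) `|u b| <= C.
    by move=> /aC; apply: le_trans; apply: ler_sum => b _; apply: ua.
  have [b|s Us|L1 u1] := @sums_to_real_nonneg (fun b => `|u b| + u b) (C + C) X.
  - by have := ler_norm (- u b); rewrite normrN; lra.
  - rewrite big_split lerD ?uC //; apply: le_trans (uC _ Us).
    by apply: ler_sum => b _; apply: ler_norm.
  have [//|//|L2 u2] := @sums_to_real_nonneg (fun b => `|u b|) C X.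
  exists (L1 - L2); apply: eq_sums_to (sums_toB u1 u2) => b.
  by rewrite -scalerBl -rmorphB addrC addKr.
have entry_sums i j : exists L, sums_to (fun b => a b i j *: delta_mx i j) L.
  have [|L1 a1] := @real_sums (fun b => complex.Re (a b i j)) (delta_mx i j).
    by move=> b; apply: le_trans (ler_abs1_nrm _ i j); rewrite lerDl.
  have [|L2 a2] := @real_sums (fun b => complex.Im (a b i j)) ('i%C *: delta_mx i j).
    by move=> b; apply: le_trans (ler_abs1_nrm _ i j); rewrite lerDr.
  exists (L1 + L2); apply: eq_sums_to (sums_toD a1 a2) => b.
  by rewrite scalerA -scalerDl [_ * 'i%C]mulrC -complexE.
have [L LP] : exists L : 'I_N -> 'I_N -> M,
    forall i j, sums_to (fun b => a b i j *: delta_mx i j) (L i j).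
  have /choice[L LP] : forall ij : 'I_N * 'I_N, exists L,
      sums_to (fun b => a b ij.1 ij.2 *: delta_mx ij.1 ij.2) L.
    by move=> [i j]; apply: entry_sums.
  by exists (fun i j => L (i, j)) => i j; apply: LP (i, j).
exists (\sum_i \sum_j L i j).
apply: (@eq_sums_to (fun b => \sum_i \sum_j a b i j *: delta_mx i j)).
  by move=> b; rewrite -matrix_sum_delta.
by apply: sums_to_sum => i; apply: sums_to_sum => j; apply: LP.
Qed.

End OneFamily.
End UnconditionalSums.

Section CauchyProduct.
Variables (R : realType) (N : nat) (I : exponentType).
Local Notation M := 'M[R[i]]_N.
Implicit Types f g : fseries I M.

Lemma sum_pairs_le (J K : eqType) (u : J -> R) (v : K -> R) (C D : R) r :
  (forall j, 0 <= u j) -> (forall k, 0 <= v k) ->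
  (forall s, uniq s -> \sum_(j <- s) u j <= C) ->
  (forall s, uniq s -> \sum_(k <- s) v k <= D) ->
  uniq r -> \sum_(p <- r) u p.1 * v p.2 <= C * D.
Proof.
move=> u0 v0 uC vD Ur; pose s := undup (unzip1 r); pose t := undup (unzip2 r).
have uv0 (p : J * K) : 0 <= u p.1 * v p.2 by rewrite mulr_ge0.
have Ust : uniq [seq (j, k) | j <- s, k <- t].
  by rewrite allpairs_uniq ?undup_uniq // => -[? ?] [? ?].
have rst : {subset r <= [seq (j, k) | j <- s, k <- t]}.
  move=> [j k] jkr; apply/allpairsP; exists (j, k); rewrite !mem_undup.
  by split=> //; apply/mapP; exists (j, k).
apply: le_trans (sub_uniq_sum uv0 Ur Ust rst) _.
rewrite big_allpairs; under eq_bigr do rewrite /= -mulr_sumr.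
rewrite -mulr_suml; apply: ler_pM; rewrite ?sumr_ge0 ?uC ?vD ?undup_uniq //.
Qed.

Definition split_pairs (s : seq I) : seq (I * I) := [seq n | b <- s, n <- splits b].

Lemma split_pairs_uniq s : uniq s -> uniq (split_pairs s).
Proof.
move=> Us; apply: allpairs_uniq_dep => // [b _|]; first exact: splits_uniq.
move=> _ _ /allpairsPdep[b [n [_ + ->]]] /allpairsPdep[b' [n' [_ + ->]]] /=.
by rewrite !mem_splits => /eqP <- /eqP <- ->.
Qed.

Lemma mem_split_pairs s n : (n \in split_pairs s) = (n.1 + n.2 \in s).
Proof.
apply/allpairsPdep/idP => [[b [m [bs + ->]]]|ns].
  by rewrite mem_splits => /eqP ->.
by exists (n.1 + n.2), n; rewrite mem_splits eqxx.
Qed.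

Lemma abs_boundedM f g C D : abs_bounded f C -> abs_bounded g D ->
  abs_bounded (f * g) (C * D).
Proof.
move=> fC gD s Us.
apply: (@le_trans _ _ (\sum_(n <- split_pairs s) nrm (f n.1) * nrm (g n.2))).
  rewrite /split_pairs big_allpairs_dep; apply: ler_sum => b _.
  by apply: le_trans (ler_nrm_sum _ _ _) _; apply: ler_sum => n _; apply: ler_nrmM.
apply: (sum_pairs_le (u := fun b => nrm (f b)) (v := fun b => nrm (g b))) => //.
- by move=> b; apply: nrm_ge0.
- by move=> b; apply: nrm_ge0.
- exact: split_pairs_uniq.
Qed.

(** Once a finite set of exponents carries almost all of [f] and of [g], the
    sums of two of them carry almost all of [f * g]. *)
Lemma sums_toM f g C D A B : abs_bounded f C -> abs_bounded g D ->
  sums_to f A -> sums_to g B -> sums_to (f * g) (A * B).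
Proof.
move=> fC gD fA gB e e0.
have C0 := abs_bounded_ge0 fC; have D0 := abs_bounded_ge0 gD.
pose K := 1 + (D + D + C + nrm A).
have K0 : 0 < K by rewrite ltr_pwDl ?addr_ge0 ?nrm_ge0.
pose h := e / K; have h0 : 0 < h by rewrite divr_gt0.
have [s1 [Us1 s1P]] := fA _ h0; have [s2 [Us2 s2P]] := abs_bounded_tail fC h0.
have [t1 [Ut1 t1P]] := gB _ h0; have [t2 [Ut2 t2P]] := abs_bounded_tail gD h0.
pose s0 := undup (s1 ++ s2); pose t0 := undup (t1 ++ t2).
have Us0 : uniq s0 by apply: undup_uniq.
have Ut0 : uniq t0 by apply: undup_uniq.
exists (undup [seq n + m | n <- s0, m <- t0]); split; first exact: undup_uniq.
move=> s Us ss.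
pose r := split_pairs s; have Ur : uniq r by apply: split_pairs_uniq.
pose q (n : I * I) := (n.1 \in s0) && (n.2 \in t0).
have fgE : \sum_(b <- s) (f * g) b = (\sum_(b <- s0) f b) * (\sum_(b <- t0) g b)
    + \sum_(n <- r | ~~ q n) f n.1 * g n.2.
  have -> : \sum_(b <- s) (f * g) b = \sum_(n <- r) f n.1 * g n.2.
    by rewrite /r /split_pairs big_allpairs_dep.
  rewrite (bigID q) /=; congr (_ + _).
  rewrite mulr_suml; under [RHS]eq_bigr do rewrite mulr_sumr.
  rewrite -(big_allpairs (F := fun n => f n.1 * g n.2)) -big_filter.
  apply: eq_sum_uniq; rewrite ?filter_uniq //.
    by rewrite allpairs_uniq // => -[? ?] [? ?].
  move=> [n m]; rewrite mem_filter; apply/andP/allpairsP => [[/andP[ns mt] _]|].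
    by exists (n, m).
  case=> -[n' m'] /= [ns mt [-> ->]]; split; first by rewrite /q ns mt.
  rewrite mem_split_pairs ss // mem_undup; apply/allpairsP.
  by exists (n', m').
have rest : nrm (\sum_(n <- r | ~~ q n) f n.1 * g n.2) <= h * D + C * h.
  apply: le_trans (ler_nrm_sum _ _ _) _.
  pose u b := if b \in s0 then 0 else nrm (f b).
  pose v b := if b \in t0 then 0 else nrm (g b).
  have u0 b : 0 <= u b by rewrite /u; case: ifP; rewrite ?nrm_ge0.
  have v0 b : 0 <= v b by rewrite /v; case: ifP; rewrite ?nrm_ge0.
  apply: (@le_trans _ _ (\sum_(n <- r) u n.1 * nrm (g n.2)
      + \sum_(n <- r) nrm (f n.1) * v n.2)).
    rewrite big_mkcond -big_split; apply: ler_sum => n _ /=.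
    have fg0 : 0 <= nrm (f n.1) * nrm (g n.2) by rewrite mulr_ge0 ?nrm_ge0.
    rewrite /q negb_and /u /v; case: (n.1 \in s0); case: (n.2 \in t0) => /=.
    - by rewrite mul0r mulr0 addr0.
    - by rewrite mul0r add0r ler_nrmM.
    - by rewrite mulr0 addr0 ler_nrmM.
    - by apply: le_trans (ler_nrmM _ _) _; rewrite lerDl.
  have nf0 b : 0 <= nrm (f b) by apply: nrm_ge0.
  have ng0 b : 0 <= nrm (g b) by apply: nrm_ge0.
  apply: lerD.
    apply: (sum_pairs_le (u := u) (v := fun b => nrm (g b))) => // t Ut.
    rewrite /u; under eq_bigr do rewrite -if_neg.
    rewrite -big_mkcond -big_filter ltW // s2P ?filter_uniq // => b.
    by rewrite mem_filter mem_undup mem_cat negb_or => /andP[/andP[]].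
  apply: (sum_pairs_le (u := fun b => nrm (f b)) (v := v)) => // t Ut.
  rewrite /v; under eq_bigr do rewrite -if_neg.
  rewrite -big_mkcond -big_filter ltW // t2P ?filter_uniq // => b.
  by rewrite mem_filter mem_undup mem_cat negb_or => /andP[/andP[]].
have s1s0 : {subset s1 <= s0} by move=> b bs; rewrite mem_undup mem_cat bs.
have t1t0 : {subset t1 <= t0} by move=> b bt; rewrite mem_undup mem_cat bt.
have := s1P _ Us0 s1s0; have := t1P _ Ut0 t1t0.
have := gD _ Ut0; have := ler_nrm_sum t0 xpredT g.
rewrite fgE; set X := \sum_(b <- s0) f b; set Y := \sum_(b <- t0) g b.
set Q := \sum_(n <- r | _) _ => Yn YD YB XA.
have -> : X * Y + Q - A * B = (X - A) * Y + A * (Y - B) + Q.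
  by rewrite mulrBl mulrBr addrA subrK addrAC.
have lt1 : nrm ((X - A) * Y) <= h * D.
  apply: le_trans (ler_nrmM _ _) _; apply: ler_pM; rewrite ?nrm_ge0 //.
    exact: ltW.
  exact: le_trans Yn YD.
have lt2 : nrm (A * (Y - B)) <= nrm A * h.
  by apply: le_trans (ler_nrmM _ _) _; rewrite ler_wpM2l ?nrm_ge0 ?ltW.
have := ler_nrmD ((X - A) * Y + A * (Y - B)) Q.
have := ler_nrmD ((X - A) * Y) (A * (Y - B)).
have eE : e = h + (h * D + h * D + C * h + nrm A * h).
  by rewrite /h -[e in LHS](divfK (lt0r_neq0 K0)) /K; ring.
lra.
Qed.

Lemma abs_bounded_const t : abs_bounded (fconst t : fseries I M) (nrm t).
Proof.
move=> s Us; have [s0|/negP s0] := boolP (0 \in s).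
  rewrite (bigD1_seq 0) // fcoef_const eqxx big1 => [|b /negPf b0].
    by rewrite /= addr0.
  by rewrite fcoef_const b0 nrm0.
rewrite big_seq big1 ?nrm_ge0 // => b bs; rewrite fcoef_const.
by case: eqP => [b0|]; rewrite ?nrm0 //; case: s0; rewrite -b0.
Qed.

Lemma sums_to_const t : sums_to (fconst t : fseries I M) t.
Proof.
move=> e e0; exists [:: 0]; split=> // s Us s0.
rewrite (bigD1_seq 0) ?s0 ?mem_head // fcoef_const eqxx big1 => [|b /negPf b0].
  by rewrite /= addr0 subrr nrm0.
by rewrite fcoef_const b0.
Qed.
End CauchyProduct.

(** * Power series *)

Section PowerSeries.
Variables (R : realType) (N d : nat).
Local Notation M := 'M[R[i]]_N.
Local Notation mi := (multiindex d).
Implicit Types (f g : fseries mi M) (x : 'rV[R]_d).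

Lemma mi_powD x (a b : mi) : mi_pow x (a + b) = mi_pow x a * mi_pow x b.
Proof. by rewrite -big_split; apply: eq_bigr => j _; rewrite ffunE exprD. Qed.

Lemma mi_pow_exp0 x : mi_pow x 0 = 1.
Proof. by rewrite /mi_pow big1 // => j _; rewrite ffunE. Qed.

Lemma mi_pow_const (r : R) (b : mi) : mi_pow (const_mx r) b = r ^+ mi_deg b.
Proof.
by rewrite /mi_pow /mi_deg expr_sum; apply: eq_bigr => j _; rewrite mxE.
Qed.

(** The terms of [f] at [x], again as a formal series: [ev x] is then
    multiplicative, and results on sums of families apply to power series. *)
Definition ev x f : fseries mi M := Series (fun b => (mi_pow x b)%:C%C *: f b).

Lemma evE x f b : ev x f b = (mi_pow x b)%:C%C *: f b. Proof. by []. Qed.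

Lemma evM x f g : ev x (f * g) = ev x f * ev x g.
Proof.
apply: fseriesP => b; rewrite evE !fcoefM scaler_sumr !big_seq.
apply: eq_bigr => n; rewrite mem_splits => /eqP <-.
rewrite !evE mi_powD rmorphM -scalerA.
by rewrite -[RHS]/((_ *: _) *m (_ *: _)) -scalemxAl -scalemxAr.
Qed.

Lemma evD x f g : ev x (f + g) = ev x f + ev x g.
Proof. by apply: fseriesP => b; rewrite evE !fcoefD scalerDr. Qed.

Lemma ev_const x t : ev x (fconst t) = fconst t.
Proof.
apply: fseriesP => b; rewrite evE fcoef_const.
by case: eqP => [->|_]; rewrite ?scaler0 // mi_pow_exp0 rmorph1 scale1r.
Qed.

Lemma ev0 f : ev 0 f = fconst (f 0).
Proof.
apply: fseriesP => b; rewrite evE fcoef_const.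
have [->|/eqP b0] := eqVneq b 0; first by rewrite mi_pow_exp0 rmorph1 scale1r.
suff -> : mi_pow (0 : 'rV[R]_d) b = 0 by rewrite rmorph0 scale0r.
have /existsP[j bj] : [exists j, b j != 0%N].
  apply: contra_notT b0; rewrite negb_exists => /forallP b0.
  by apply/ffunP => j; rewrite ffunE; apply/eqP; rewrite -[_ == _]negbK b0.
by rewrite /mi_pow (bigD1 j) //= mxE expr0n (negPf bj) mul0r.
Qed.

Lemma ler_norm_mi_pow x (r : R) (b : mi) : (forall j, `|x 0 j| <= r) ->
  `|mi_pow x b| <= r ^+ mi_deg b.
Proof.
move=> xr; rewrite -mi_pow_const normr_prod; apply: ler_prod => j _.
by rewrite normr_ge0 normrX mxE lerXn2r ?nnegrE ?normr_ge0 // (le_trans _ (xr j)).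
Qed.

Lemma abs_bounded_ev x (r : R) f C : (forall j, `|x 0 j| <= r) ->
  abs_bounded (ev (const_mx r) f) C -> abs_bounded (ev x f) C.
Proof.
move=> xr; apply: abs_bounded_dom => b; rewrite !evE !nrmZ mi_pow_const.
apply: ler_wpM2r; first exact: nrm_ge0.
by apply: le_trans (ler_norm_mi_pow b xr) _; apply: ler_norm.
Qed.

Lemma geometric_le2 n : \sum_(k < n) (2^-1 : R) ^+ k <= 2.
Proof.
suff -> : \sum_(k < n) (2^-1 : R) ^+ k = 2 - 2 * 2^-1 ^+ n.
  by rewrite gerBl mulr_ge0 // exprn_ge0 // invr_ge0.
elim: n => [|n IH]; first by rewrite big_ord0 expr0 mulr1 subrr.
by rewrite big_ord_recr /= IH exprS; field.
Qed.

Lemma mi_geometric_bound (s : seq mi) : uniq s ->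
  \sum_(b <- s) (2^-1 : R) ^+ mi_deg b <= 2 ^+ d.
Proof.
move=> Us; pose n := \max_(b <- s) mi_deg b.
pose box := [seq [ffun j => nat_of_ord (k j)] | k : {ffun 'I_d -> 'I_n.+1}].
have Ubox : uniq box.
  rewrite map_inj_uniq ?enum_uniq // => k l /ffunP kl.
  by apply/ffunP => j; apply/val_inj; have := kl j; rewrite !ffunE.
have sbox : {subset s <= box}.
  move=> b bs.
  have bn j : (b j < n.+1)%N.
    by rewrite ltnS (leq_trans (leq_mi_deg b j)) // (leq_bigmax_seq _ bs).
  apply/mapP; exists [ffun j => Ordinal (bn j)]; rewrite ?mem_enum //.
  by apply/ffunP => j; rewrite !ffunE.
have pos (b : mi) : 0 <= (2^-1 : R) ^+ mi_deg b by rewrite exprn_ge0 ?invr_ge0.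
apply: le_trans (sub_uniq_sum pos Us Ubox sbox) _.
rewrite big_map big_enum /=.
apply: (@le_trans _ _ (\prod_(j < d) \sum_(k < n.+1) (2^-1 : R) ^+ k)).
  rewrite bigA_distr_bigA /=; apply: ler_sum => k _.
  rewrite /mi_deg expr_sum; apply: ler_prod => j _.
  by rewrite ffunE lexx andbT exprn_ge0 ?invr_ge0.
rewrite -[in leRHS](card_ord d) -prodr_const; apply: ler_prod => j _.
by rewrite geometric_le2 andbT sumr_ge0 // => k _; rewrite exprn_ge0 ?invr_ge0.
Qed.

(** Beyond a finite set, adding one more term moves the sum by less than 2. *)
Lemma sums_to_bounded (I : eqType) (a : I -> M) L : sums_to a L ->
  exists C, forall b, nrm (a b) <= C.
Proof.
move=> /(_ 1 ltr01)[s [Us sP]].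
exists (2 + \sum_(b <- s) nrm (a b)) => b; have [bs|bs] := boolP (b \in s).
  rewrite (bigD1_seq b) //= addrCA lerDl addr_ge0 ?sumr_ge0 // => *.
  exact: nrm_ge0.
have Ubs : uniq (b :: s) by rewrite /= bs.
have := sP _ Ubs (fun c cs => mem_behead (s := b :: s) cs).
rewrite big_cons; have := sP s Us (fun _ => id); set X := \sum_(c <- s) _ => X1 bX1.
have := ler_nrmB (a b + X - L) (X - L).
rewrite opprB addrA subrK addrK => bX.
have : 0 <= \sum_(c <- s) nrm (a c) by apply: sumr_ge0 => *; apply: nrm_ge0.
lra.
Qed.

(** From the radius [r] to [u * 2^-1 * r], a term of weight at least 1 gains
    the factor [2^-1 ^+ weight], which makes the terms summable, and a factor
    at most [u], which makes their sum small. *)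
Lemma small_radius f (r C e : R) : 0 < r -> f 0 = 0 ->
  (forall b, nrm (ev (const_mx r) f b) <= C) -> 0 < e ->
  exists2 rho, 0 < rho & abs_bounded (ev (const_mx rho) f) e.
Proof.
move=> r0 f0 fC e0.
have C0 : 0 <= C by apply: le_trans (fC 0); apply: nrm_ge0.
have d0 : 0 < 2 ^+ d :> R by rewrite exprn_gt0.
pose K := C * 2 ^+ d + 1; have K0 : 0 < K by rewrite ltr_wpDl // mulr_ge0 // ltW.
pose u := Num.min 1 (e / K).
have u0 : 0 < u by rewrite lt_min ltr01 divr_gt0.
have u1 : u <= 1 by rewrite ge_min lexx.
have ue : u * (C * 2 ^+ d) <= e.
  apply: (@le_trans _ _ (e / K * K)); last by rewrite divfK ?lt0r_neq0.
  apply: ler_pM; [exact: ltW | by rewrite mulr_ge0 // ltW | |].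
    by rewrite ge_min lexx orbT.
  by rewrite /K lerDl.
exists (u * 2^-1 * r) => [|s Us]; first by rewrite !mulr_gt0 ?invr_gt0.
apply: le_trans ue; apply: (@le_trans _ _ (\sum_(b <- s) u * C * 2^-1 ^+ mi_deg b)).
  apply: ler_sum => b _; have [->|b0] := eqVneq b 0.
    by rewrite evE f0 scaler0 nrm0 !mulr_ge0 ?exprn_ge0 ?invr_ge0 // ltW.
  have degb : (0 < mi_deg b)%N by rewrite lt0n mi_deg_eq0.
  have := fC b; rewrite !evE !nrmZ !mi_pow_const !exprMn !normrM => fb.
  rewrite -!mulrA; apply: ler_pM.
  - by rewrite normr_ge0.
  - by rewrite !mulr_ge0 ?nrm_ge0.
  - rewrite (ger0_norm (exprn_ge0 _ (ltW u0))) -(prednK degb) exprS ger_pMr //.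
    by rewrite exprn_ile1 ?(ltW u0).
  - rewrite ger0_norm ?exprn_ge0 ?invr_ge0 // [leRHS]mulrC.
    by rewrite ler_wpM2l ?exprn_ge0 ?invr_ge0.
rewrite -mulr_sumr -mulrA (ler_wpM2l (ltW u0)) // (ler_wpM2l C0) //.
exact: mi_geometric_bound.
Qed.

End PowerSeries.

(** * Convergence of Kato's series *)

Section KatoBound.
Variables (R : realType) (N d : nat).
Local Notation M := 'M[R[i]]_N.
Local Notation mi := (multiindex d).
Variables (P0 S0 : M) (E : fseries mi M) (x : 'rV[R]_d) (e : R).
Hypothesis Ee : abs_bounded (ev x E) e.

Let c := 1 + nrm P0.
Let s := 1 + nrm S0.

Let c0 : 0 <= c. Proof. by rewrite addr_ge0 ?nrm_ge0. Qed.
Let s0 : 0 <= s. Proof. by rewrite addr_ge0 ?nrm_ge0. Qed.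
Let e0 : 0 <= e. Proof. exact: abs_bounded_ge0 Ee. Qed.

Lemma nrm_spow t : nrm (spow P0 S0 t) <= c * s ^+ t.
Proof.
case: t => [|t]; first by rewrite /= nrmN mulr1 lerDr.
apply: le_trans (ler_nrmX _ _) _; rewrite -[leLHS]mul1r.
apply: ler_pM; rewrite ?exprn_ge0 ?nrm_ge0 // ?lerDl ?nrm_ge0 //.
by rewrite lerXn2r ?nnegrE ?nrm_ge0 // lerDr.
Qed.

(** The sum over [i] of [s ^ i (2 s) ^ (m - i)] is
    [(2 s) ^ m (1 + 1/2 + ... + 1/2 ^ m)]. *)
Lemma sum_splits_nat m :
  \sum_(n <- splits m) s ^+ n.1 * (2 * s) ^+ n.2 <= 2 * (2 * s) ^+ m.
Proof.
suff -> : \sum_(n <- splits m) s ^+ n.1 * (2 * s) ^+ n.2 =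
    2 * (2 * s) ^+ m - s ^+ m by rewrite gerBl exprn_ge0.
have -> : \sum_(n <- splits m) s ^+ n.1 * (2 * s) ^+ n.2 =
    \sum_(0 <= i < m.+1) s ^+ i * (2 * s) ^+ (m - i).
  by rewrite -[splits m]/[seq (i, (m - i)%N) | i <- iota 0 m.+1] big_map.
elim: m => [|m IH]; first by rewrite big_nat1 !expr0; ring.
rewrite big_nat_recr // subnn expr0 mulr1.
rewrite (eq_big_nat _ _ (F2 := fun i => (2 * s) * (s ^+ i * (2 * s) ^+ (m - i)))).
  by rewrite -mulr_sumr IH !exprS /=; ring.
by move=> i im; rewrite subSn // exprS mulrCA.
Qed.

Lemma kato_orderS p m b : kato_order P0 S0 E p.+1 m b =
  \sum_(n <- splits m)
    (fconst (spow P0 S0 n.1) * (E * kato_order P0 S0 E p n.2)) b.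
Proof.
rewrite /kato_order exprS -mulrA -/(kato_order P0 S0 E p) fcoefM fcoef_sum.
by apply: eq_bigr => n _; rewrite fcoef_constM.
Qed.

(** The factor [2 ^ m] absorbs the number of ways of distributing the exponent
    [m] of [zeta]; it turns the recursion on [p] into a geometric one. *)
Lemma kato_order_bound p m :
  abs_bounded (ev x (kato_order P0 S0 E p m))
    (2 * c * (2 * c * e) ^+ p * (2 * s) ^+ m).
Proof.
elim: p m => [|p IH] m.
  rewrite expr0 mulr1 /kato_order expr0 mulr1 ev_const.
  apply: abs_bounded_le (abs_bounded_const (spow P0 S0 m)) _.
  apply: le_trans (nrm_spow m) _; rewrite exprMn mulrACA.
  rewrite ler_peMl ?mulr_ge0 ?exprn_ge0 //.
  by rewrite -exprS exprn_ege1 // ler1n.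
pose F (n : nat * nat) :=
  ev x (fconst (spow P0 S0 n.1) * (E * kato_order P0 S0 E p n.2)).
have FC n : abs_bounded (F n) (c * s ^+ n.1 *
    (e * (2 * c * (2 * c * e) ^+ p * (2 * s) ^+ n.2))).
  rewrite /F !evM ev_const; apply: abs_boundedM; last exact: abs_boundedM.
  exact: abs_bounded_le (abs_bounded_const _) (nrm_spow _).
have := abs_bounded_sum (splits m) FC.
move=> /(abs_bounded_le (D := 2 * c * (2 * c * e) ^+ p.+1 * (2 * s) ^+ m)) FD.
apply: (@abs_bounded_dom _ _ _ _ (fun b => \sum_(n <- splits m) F n b)); last first.
  apply: FD; rewrite (eq_bigr (fun n => (c * e * (2 * c * (2 * c * e) ^+ p)) *
    (s ^+ n.1 * (2 * s) ^+ n.2))); last by move=> n _; ring.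
  rewrite -mulr_sumr; apply: le_trans (ler_wpM2l _ (sum_splits_nat m)) _.
    by rewrite !mulr_ge0 ?exprn_ge0 ?mulr_ge0.
  by rewrite exprS le_eqVlt; apply/orP; left; apply/eqP; ring.
by move=> b; rewrite evE kato_orderS scaler_sumr.
Qed.

(** The residue involves the diagonal terms [m = p] of the previous bound only,
    which decrease like [2^-1 ^+ p] for a small perturbation. *)
Lemma kato_series_bound : 8 * c * s * e <= 1 ->
  abs_bounded (ev x (kato_series P0 S0 E)) (4 * c).
Proof.
move=> e1 r Ur; pose n := (\max_(b <- r) weight b).+1.
pose F p := ev x (kato_order P0 S0 E p p).
have FC p : abs_bounded (F p) (2 * c * 2^-1 ^+ p).
  apply: abs_bounded_le (kato_order_bound p p) _.
  rewrite -mulrA -exprMn; apply: ler_wpM2l; first by rewrite mulr_ge0.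
  rewrite lerXn2r ?nnegrE ?invr_ge0 // ?mulr_ge0 //; lra.
apply: (@le_trans _ _ (\sum_(b <- r) \sum_(p < n) nrm (F p b))).
  rewrite !big_seq; apply: ler_sum => b br; rewrite evE /= scalerN nrmN.
  rewrite scaler_sumr.
  have bn : (weight b < n)%N by rewrite ltnS leq_bigmax_seq.
  apply: le_trans (ler_nrm_sum _ _ _) _.
  rewrite (big_ord_widen n (fun p => nrm ((mi_pow x b)%:C%C *:
    ((-1) ^+ p * kato_order P0 S0 E p p b)))) //.
  rewrite big_mkcond; apply: ler_sum => p _; case: ifP => _; last exact: nrm_ge0.
  rewrite -signr_odd; case: odd; rewrite ?expr1 ?mulN1r ?scalerN ?nrmN //.
  by rewrite mul1r.
rewrite exchange_big; apply: (@le_trans _ _ (\sum_(p < n) 2 * c * 2^-1 ^+ p)).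
  by apply: ler_sum => p _; apply: FC.
rewrite -mulr_sumr; apply: (@le_trans _ _ (2 * c * 2)); last by lra.
by apply: ler_wpM2l; rewrite ?mulr_ge0 // geometric_le2.
Qed.
End KatoBound.

(** * Uniqueness of power series coefficients *)

Section IdentityTheorem.
Variables (R : realType) (N d : nat).
Local Notation M := 'M[R[i]]_N.
Local Notation mi := (multiindex d).
Implicit Types (f : fseries mi M) (x : 'rV[R]_d).

Lemma poly_eq0_interval (p : {poly R[i]}) (r : R) : 0 < r ->
  (forall t, 0 < t <= r -> p.[t%:C%C] = 0) -> p = 0.
Proof.
move=> r0 pr; pose rs := [seq (r / n.+1%:R)%:C%C | n <- iota 0 (size p)] : seq R[i].
apply: (@roots_geq_poly_eq0 _ _ rs); last by rewrite size_map size_iota.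
  apply/allP => _ /mapP[n _ ->]; apply/eqP/pr.
  by rewrite divr_gt0 // ler_pdivrMr // ler_peMr ?ler1n // ltW.
rewrite map_inj_uniq ?iota_uniq // => m n /complexI /(mulfI (lt0r_neq0 r0)).
by move=> /invr_inj /eqP; rewrite eqr_nat => /eqP [].
Qed.

(** As a polynomial in the variable [j] alone, the sum has infinitely many
    roots, hence vanishing coefficients; the new sum is one of them, times a
    power of [x 0 j]. *)
Lemma vanish_slice f (r : R) (s : seq mi) j l : 0 < r ->
  (forall x, (forall k, 0 < x 0 k <= r) -> \sum_(b <- s) ev x f b = 0) ->
  forall x, (forall k, 0 < x 0 k <= r) -> \sum_(b <- s | b j == l) ev x f b = 0.
Proof.
move=> r0 fs x xr; apply/matrixP => u v; rewrite summxE mxE.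
pose q (b : mi) : R := \prod_(k | k != j) x 0 k ^+ b k.
pose p : {poly R[i]} := \sum_(b <- s) ((q b)%:C%C * f b u v) *: 'X^(b j).
have p0 : p = 0.
  apply: (poly_eq0_interval r0) => t tr.
  pose y : 'rV[R]_d := \row_k (if k == j then t else x 0 k).
  have yr k : 0 < y 0 k <= r by rewrite mxE; case: ifP.
  have := congr1 (fun A : M => A u v) (fs y yr); rewrite summxE mxE => fy.
  rewrite -[RHS]fy horner_sum; apply: eq_bigr => b _.
  rewrite hornerZ hornerXn mxE mulrAC; congr (_ * _).
  rewrite -rmorphXn -rmorphM /mi_pow (bigD1 j) //= mxE eqxx mulrC; congr (_ * _)%:C%C.
  by apply: eq_bigr => k /negPf kj; rewrite mxE kj.
have := congr1 (fun h : {poly R[i]} => h`_l) p0; rewrite coef0 coef_sum => pl.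
transitivity ((x 0 j ^+ l)%:C%C * 0); last by rewrite mulr0.
rewrite -[X in _ * X]pl mulr_sumr big_mkcond.
apply: eq_bigr => b _; rewrite coefZ coefXn eq_sym; case: eqP => [bj|_]; last first.
  by rewrite !mulr0.
rewrite mulr1 mxE mulrA -rmorphM; congr (_%:C%C * _).
by rewrite /mi_pow (bigD1 j) //= bj.
Qed.

(** Slicing along all variables leaves a single monomial. *)
Lemma polynomial_identity f (r : R) (s : seq mi) : 0 < r -> uniq s ->
  (forall x, (forall k, 0 < x 0 k <= r) -> \sum_(b <- s) ev x f b = 0) ->
  {in s, forall b, f b = 0}.
Proof.
move=> r0 Us fs b0 b0s.
have slice (J : seq 'I_d) x : (forall k, 0 < x 0 k <= r) ->
    \sum_(b <- s | all (fun j => b j == b0 j) J) ev x f b = 0.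
  elim: J x => [|j J IH] x xr /=; first exact: fs.
  rewrite (eq_bigl (fun b : mi => all (fun k => b k == b0 k) J && (b j == b0 j)));
    last by move=> b; rewrite andbC.
  rewrite -big_filter_cond; apply: (@vanish_slice f r _ j (b0 j) r0 _ x xr) => y yr.
  by rewrite big_filter; apply: IH.
have xr k : 0 < (const_mx r : 'rV[R]_d) 0 k <= r by rewrite mxE r0 /=.
have := slice (enum 'I_d) _ xr.
rewrite (eq_bigl (pred1 b0)) => [|b]; last first.
  apply/allP/eqP => [bb0|-> //]; apply/ffunP => j; apply/eqP/bb0.
  by rewrite mem_enum.
rewrite -big_filter filter_pred1_uniq // big_seq1 evE mi_pow_const.
move=> /(congr1 (fun A => ((r ^+ mi_deg b0)%:C%C)^-1 *: A)).
rewrite scaler0 scalerA mulVf ?scale1r // (inj_eq (@complexI R) _ 0).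
by rewrite expf_neq0 // lt0r_neq0.
Qed.

(** By induction on the degree: the homogeneous part of least degree [k]
    dominates the others at [t x] as [t] tends to 0, hence vanishes. *)
Lemma power_series_identity f (r C : R) : 0 < r ->
  abs_bounded (ev (const_mx r) f) C ->
  (forall x, (forall k, 0 < x 0 k <= r) -> sums_to (ev x f) 0) -> f = 0.
Proof.
move=> r0 fC f0; apply: fseriesP => b0; rewrite fcoef0.
have C0 := abs_bounded_ge0 fC.
have [n] := ubnP (mi_deg b0); elim: n b0 => // n IH b0; rewrite ltnS => b0n.
pose k := mi_deg b0; pose s : seq mi := comps d k.
have mem_s (b : mi) : (b \in s) = (mi_deg b == k) by rewrite mem_comps.
have f_low b : (mi_deg b < k)%N -> f b = 0.
  by move=> bk; apply: IH; apply: leq_trans bk b0n.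
apply: (polynomial_identity (f := f) r0 (comps_uniq d k)); last by rewrite mem_s.
move=> x xr; set h := \sum_(b <- _) _; apply: nrm_eq0; apply/le_anti.
rewrite nrm_ge0 andbT; apply/ler_addgt0Pl => e e0; rewrite addr0.
pose t := Num.min 1 (e / (C + 1)); have C10 : 0 < C + 1 by rewrite ltr_wpDl.
have t0 : 0 < t by rewrite lt_min ltr01 divr_gt0.
have t1 : t <= 1 by rewrite ge_min lexx.
have te : t * (C + 1) <= e by rewrite -ler_pdivlMr // ge_min lexx orbT.
apply: le_trans te; pose tx := t *: x.
have txr j : 0 < tx 0 j <= r.
  have /andP[xj0 xjr] := xr j; rewrite mxE mulr_gt0 //=.
  by rewrite (le_trans _ xjr) // ger_pMl.
have ev_tx b : ev tx f b = (t ^+ mi_deg b)%:C%C *: ev x f b.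
  rewrite !evE scalerA -rmorphM; congr (_%:C%C *: _).
  rewrite /mi_pow /mi_deg expr_sum -big_split.
  by apply: eq_bigr => j _; rewrite mxE exprMn.
have tk0 : 0 < t ^+ k.+1 by rewrite exprn_gt0.
have [s0 [Us0 s0P]] := f0 tx txr _ tk0.
pose u := undup (s0 ++ s).
have s0u : {subset s0 <= u} by move=> b bs; rewrite mem_undup mem_cat bs.
have := s0P u (undup_uniq _) s0u.
rewrite subr0 (bigID (fun b : mi => mi_deg b == k)) /=.
have -> : \sum_(b <- u | mi_deg b == k) ev tx f b = (t ^+ k)%:C%C *: h.
  rewrite -big_filter (@eq_sum_uniq _ _ _ s) ?filter_uniq ?undup_uniq ?comps_uniq //.
    rewrite /h scaler_sumr !big_seq; apply: eq_bigr => b; rewrite mem_s => /eqP bk.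
    by rewrite ev_tx bk.
  move=> b; rewrite mem_filter mem_undup mem_cat mem_s.
  by case: eqP => //= _; rewrite orbT.
set Q := \sum_(b <- u | _) _ => hQ.
have Qle : nrm Q <= t ^+ k.+1 * C.
  apply: le_trans (ler_nrm_sum _ _ _) _.
  have xC : abs_bounded (ev x f) C.
    apply: abs_bounded_ev fC => j; have /andP[xj0 xjr] := xr j.
    by rewrite gtr0_norm.
  apply: (@le_trans _ _ (\sum_(b <- u) t ^+ k.+1 * nrm (ev x f b))); last first.
    by rewrite -mulr_sumr ler_wpM2l ?xC ?undup_uniq // exprn_ge0 // ltW.
  rewrite big_mkcond; apply: ler_sum => b _; case: ifPn => [bk|_]; last first.
    by rewrite mulr_ge0 ?nrm_ge0 // exprn_ge0 // ltW.
  have [blt|] := ltnP (mi_deg b) k.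
    by rewrite !evE f_low // !scaler0 nrm0 mulr0.
  rewrite leq_eqVlt eq_sym (negPf bk) /= => bgt.
  rewrite -!evE ev_tx nrmZ (ger0_norm (exprn_ge0 _ (ltW t0))).
  apply: ler_wpM2r; first exact: nrm_ge0.
  by apply: ler_wiXn2l => //; exact: ltW.
have : nrm ((t ^+ k)%:C%C *: h) <= t ^+ k.+1 * C + t ^+ k.+1.
  have := ler_nrmB ((t ^+ k)%:C%C *: h + Q) Q; rewrite addrK; lra.
rewrite nrmZ (ger0_norm (exprn_ge0 _ (ltW t0))) exprSr -!mulrA -mulrDr.
by rewrite ler_pM2l ?exprn_gt0 // -[X in _ + X]mulr1 -mulrDr.
Qed.
End IdentityTheorem.

(** * Convergence in the topology of matrices *)

Section FilterBridge.
Variable R : realType.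

Lemma partial_sum_cvgP (V : normedModType R[i]) (I : choiceType) (a : I -> V) L :
  partial_sum a @ totally --> L <->
  forall e : R, 0 < e -> exists s0, uniq s0 /\ forall s, uniq s ->
    {subset s0 <= s} -> `|\sum_(b <- s) a b - L| < e%:C%C.
Proof.
have psE (J : {fset I}) : partial_sum a J = \sum_(b <- enum_fset J) a b.
  by rewrite big_seq_fsetE.
have totF : ProperFilter (@totally I) := @totally_filter I.
split=> [/cvgrPdist_lt aL e e0|aL].
  have [|J0 _ J0P] := aL e%:C%C; first by rewrite ltcR.
  exists (enum_fset J0); split=> [|s Us sJ]; first exact: fset_uniq.
  have [J Js] : exists J : {fset I}, J =i s.
    by exists (seq_fset tt s); exact: seq_fsetE.
  have /J0P : [set B | fsubset J0 B] J by apply/fsubsetP => b /sJ; rewrite Js.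
  by rewrite /= distrC psE (eq_sum_uniq _ (fset_uniq J) Us Js).
apply/cvgrPdist_lt => e; rewrite ltcE /= => /andP[/eqP ei e0].
have [s0 [_ s0P]] := aL _ e0.
have [J0 J0s] : exists J : {fset I}, J =i s0.
  by exists (seq_fset tt s0); exact: seq_fsetE.
exists J0 => // J /= /fsubsetP s0J.
have -> : e = (complex.Re e)%:C%C by case: e ei {e0 s0P} => u v /= ->.
rewrite distrC psE; apply: s0P; first exact: fset_uniq.
by move=> b bs; apply: s0J; rewrite J0s.
Qed.

Variable N : nat.
Implicit Types X : 'M[R[i]]_N.

Lemma ler_norm_nrm X : `|X| <= (nrm X)%:C%C.
Proof.
have [X0|/mx_norm_neq0[ij X0]] := eqVneq (mx_norm X) 0.
  by rewrite [leLHS]X0 lecR nrm_ge0.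
rewrite [leLHS]X0; apply: le_trans (ler_norm_abs1 _) _.
by rewrite lecR ler_abs1_nrm.
Qed.

Lemma ler_nrm_norm X : (nrm X)%:C%C <= `|X| *+ (2 * N * N).
Proof.
have entry i j : `|X i j| <= `|X|.
  rewrite [leRHS]mx_normE -[leLHS]nngE num_le.
  exact: (le_bigmax _ (fun ij : 'I_N * 'I_N => `|X ij.1 ij.2|%:nng) (i, j)).
move: `|X| entry => y entry.
have mulrn_sum (z : R[i]) : z *+ N = \sum_(i < N) z.
  by rewrite sumr_const card_ord.
rewrite /nrm rmorph_sum mulrnA mulrn_sum; apply: ler_sum => i _.
rewrite rmorph_sum mulrnA mulrn_sum; apply: ler_sum => j _; apply: le_trans (ler_abs1_norm _) _.
by rewrite ler_wMn2r.
Qed.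

Let V : normedModType R[i] := 'M[R[i]]_N.

Lemma sums_to_cvg (I : choiceType) (a : I -> V) (L : V) :
  @sums_to R N I a L <-> partial_sum a @ totally --> L.
Proof.
rewrite partial_sum_cvgP; split=> aL e e0.
  have [s0 [Us0 s0P]] := aL e e0; exists s0; split=> // s Us ss.
  by apply: le_lt_trans (ler_norm_nrm _) _; rewrite ltcR s0P.
have N0 : 0 < (2 * N * N).+1%:R :> R by rewrite ltr0n.
have [s0 [Us0 s0P]] := aL _ (divr_gt0 e0 N0); exists s0; split=> // s Us ss.
have := s0P s Us ss; set X := _ - L => Xe; rewrite -ltcR.
apply: le_lt_trans (ler_nrm_norm X) _.
rewrite -[e](divfK (lt0r_neq0 N0)) rmorphM rmorph_nat mulr_natr.
apply: (@le_lt_trans _ _ (`|X| *+ (2 * N * N).+1)); first by rewrite ler_wpMn2l.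
by rewrite ltr_pMn2r.
Qed.

Lemma sums_to_trace (I : choiceType) (a : I -> 'M[R[i]]_N) L : sums_to a L ->
  partial_sum (fun b => \tr (a b) : (R[i]^o : normedModType R[i])) @ totally -->
  (\tr L : (R[i]^o : normedModType R[i])).
Proof.
move=> aL; apply/partial_sum_cvgP => e /aL[s0 [Us0 s0P]].
exists s0; split=> // s Us /(s0P s Us) XL.
rewrite -raddf_sum -raddfB; set X := _ - L in XL *.
apply: (@le_lt_trans _ _ (nrm X)%:C%C); last by rewrite ltcR.
rewrite /mxtrace /nrm rmorph_sum; apply: le_trans (ler_norm_sum _ _ _) _.
apply: ler_sum => i _; apply: le_trans (ler_norm_abs1 _) _.
rewrite lecR (bigD1 i) //= lerDl; apply: sumr_ge0 => j _; exact: abs1_ge0.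
Qed.

Variable d : nat.
Implicit Types mu : 'rV[R]_d.

Lemma near_polydisc mu0 (Q : 'rV[R]_d -> Prop) :
  (\forall mu \near mu0, Q mu) <->
  exists2 r : R, 0 < r & forall mu, (forall j, `|(mu - mu0) 0 j| <= r) -> Q mu.
Proof.
split=> [/nbhs_ballP[e /= e0 eQ]|[r r0 rQ]].
  exists (e / 2) => [|mu mue]; first by rewrite divr_gt0.
  apply: eQ; split=> // i j; rewrite /ball /= distrC ord1.
  by have := mue j; rewrite !mxE => /le_lt_trans; apply; rewrite gtr_pMr // invf_lt1 ?ltr1n.
apply/nbhs_ballP; exists r => // mu [_ mur]; apply: rQ => j.
by have := mur 0 j; rewrite /ball /= distrC !mxE => /ltW.
Qed.

Lemma power_series_nearP (f : 'rV[R]_d -> 'M[R[i]]_N) mu0 (c : fseries (multiindex d) 'M[R[i]]_N) :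
  power_series_near f mu0 c <->
  \forall mu \near mu0, sums_to (ev (mu - mu0) c) (f mu).
Proof.
by split; apply: filterS => mu; rewrite -sums_to_cvg.
Qed.

End FilterBridge.

(** * The eigenprojector of an analytic family *)

Section HermitianData.
Variables (R : realType) (N : nat).
Local Notation M := 'M[R[i]]_N.
Implicit Types (A P S : M) (lam : R[i]).

Lemma adjoint_antimorphism : antimorphism (fun A : M => A^t*).
Proof.
split=> [A B||A B].
- by rewrite linearD map_mxD.
- by rewrite trmx1 map_mx1.
- by rewrite trmx_mul map_mxM.
Qed.

Lemma hermsymmxE A : (A \is hermsymmx) = (A == A^t*).
Proof. by rewrite is_hermitianmxE expr0 scale1r. Qed.

(** Each column of [P] is an eigenvector. *)
Lemma eigenprojectorE A lam P : eigenprojector A lam P -> A *m P = lam *: P.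
Proof.
move=> [_ Plam]; apply/matrixP => i j.
have : [set v | A *m v = lam *: v] (P *m delta_mx j 0 : 'cV_N).
  by rewrite -Plam; exists (delta_mx j 0).
rewrite /= mulmxA -!colE => /matrixP/(_ i 0).
by rewrite !mxE.
Qed.

(** The projector is nonzero, as otherwise [A - lam] would be invertible;
    comparing [A P = lam P] with its adjoint then shows that [lam] is real. *)
Lemma eigenvalue_real A lam P S : A^t* = A -> eigenprojector A lam P ->
  eigenvalue A lam -> S *m (A - lam%:M) = 1%:M - P ->
  (A - lam%:M) *m S = 1%:M - P -> (lam%:M : M)^t* = lam%:M.
Proof.
move=> AA eP; have AP := eigenprojectorE eP; case: eP => -[PP PH] _ Alam SD DS.
have P0 : P != 0.
  apply/eqP => P0; move/eigenvalueP: Alam => [v vA v0].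
  have : v *m ((A - lam%:M) *m S) = v by rewrite DS P0 subr0 mulmx1.
  rewrite mulmxA mulmxBr vA mul_mx_scalar subrr mul0mx => /esym/eqP.
  by rewrite (negPf v0).
have PAP : P *m A *m P = lam *: P by rewrite -mulmxA AP -scalemxAr -PP.
have PAP' : P *m A *m P = lam^* *: P.
  have := congr1 (fun B : M => B^t*) PAP; rewrite linearZ /= map_mxZ -PH.
  by rewrite !trmx_mul !map_mxM -PH AA -mulmxA => ->.
have /eqP : (lam - lam^*) *: P = 0 by rewrite scalerBl -PAP -PAP' subrr.
rewrite scaler_eq0 (negPf P0) orbF subr_eq0 => /eqP lamr.
by rewrite tr_scalar_mx map_scalar_mx /= -lamr.
Qed.

(** [S] and its adjoint satisfy the same equations; computing
    [S (A - lam) S^*] in two ways shows them equal. *)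
Lemma reduced_resolvent_adjoint A lam P S : A^t* = A -> P^t* = P ->
  (lam%:M : M)^t* = lam%:M -> reduced_resolvent A lam P S -> S^t* = S.
Proof.
move=> AA PP lamr [SP PS DS SD].
have sg := @adjoint_antimorphism.
have DD : (A - lam%:M)^t* = A - lam%:M.
  by rewrite (antimorphismD sg) (antimorphismN sg) AA lamr.
have DS' : (A - lam%:M) *m S^t* = 1%:M - P.
  transitivity ((S *m (A - lam%:M))^t*); first by rewrite trmx_mul map_mxM DD.
  by rewrite SD (antimorphismD sg) (antimorphismN sg) PP trmx1 map_mx1.
have PS' : P *m S^t* = 0.
  transitivity ((S *m P)^t*); first by rewrite trmx_mul map_mxM PP.
  by rewrite SP trmx0 map_mx0.
have : S *m (A - lam%:M) *m S^t* = S *m (A - lam%:M) *m S^t* by [].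
rewrite {1}SD -mulmxA DS' mulmxBl mulmxBr mul1mx mulmx1 PS' SP !subr0.
by [].
Qed.

Lemma rank_eigenprojector A lam P : P *m (A - lam%:M) = 0 ->
  (\rank P <= \rank (eigenspace A lam))%N.
Proof. by move=> PD; apply/mxrankS/sub_kermxP. Qed.

End HermitianData.

Section SeriesSums.
Variables (R : realType) (N d : nat).
Local Notation M := 'M[R[i]]_N.
Local Notation mi := (multiindex d).

Lemma ev_adjoint (x : 'rV[R]_d) (f : fseries mi M) b :
  (ev x f b)^t* = (mi_pow x b)%:C%C *: (f b)^t*.
Proof. by rewrite evE linearZ /= map_mxZ; congr (_ *: _); rewrite [LHS]conjc_real. Qed.

(** The series of the differences [(f b)^* - f b] sums to 0 on a polydisc. *)
Lemma hermitian_coef (f : fseries mi M) (A : 'rV[R]_d -> M) (r C : R) : 0 < r ->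
  abs_bounded (ev (const_mx r) f) C ->
  (forall x : 'rV[R]_d, (forall k, 0 < x 0 k <= r) ->
    sums_to (ev x f) (A x) /\ (A x)^t* = A x) ->
  forall b, (f b)^t* = f b.
Proof.
move=> r0 fC fA b; pose g : fseries mi M := Series (fun b => (f b)^t* - f b).
suff /(congr1 (fun h : fseries mi M => h b)) /= : g = 0.
  by move=> /eqP; rewrite subr_eq0 => /eqP.
have evg x a : ev x g a = (ev x f a)^t* - ev x f a.
  by rewrite ev_adjoint !evE scalerBr.
have gC : abs_bounded (ev (const_mx r) g) (C + C).
  apply: (@abs_bounded_dom _ _ _ _
    (fun a => (ev (const_mx r) f a)^t* - ev (const_mx r) f a)).
    by move=> a; rewrite evg.
  apply: abs_boundedD (abs_boundedN fC).
  by apply: abs_bounded_dom fC => a; rewrite nrm_adjoint.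
apply: (power_series_identity r0 gC) => x xr.
have [fx Ax] := fA x xr.
have := sums_toB (sums_to_adjoint fx) fx; rewrite Ax subrr.
by apply: eq_sums_to => a; rewrite evg.
Qed.

End SeriesSums.

Section SumsOverSplits.
Variables (R : realType) (N d : nat).
Local Notation M := 'M[R[i]]_N.
Local Notation mi := (multiindex d).

Lemma sum_split_set (Q : pred (mi * mi)) (F : mi * mi -> M) b :
  \sum_(n \in [set n | Q n /\ n.1 + n.2 = b]) F n =
  \sum_(n <- splits b | Q n) F n.
Proof.
have -> : [set n | Q n /\ n.1 + n.2 = b] = [set` [seq n <- splits b | Q n]].
  apply/seteqP; split=> n /=; rewrite mem_filter mem_splits.
    by case=> -> ->; rewrite eqxx.
  by case/andP => -> /eqP.
by rewrite -fsbig_seq ?filter_uniq ?splits_uniq // big_filter.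
Qed.

(** Restricting to nonzero exponents amounts to removing constant terms. *)
Lemma Zcoef_splits (P : fseries mi M) b :
  Zcoef P b = ((P - fconst (P 0)) * (P - fconst (P 0))) b.
Proof.
rewrite /Zcoef.
have -> : [set n : mi * mi | [/\ n.1 != 0, n.2 != 0 & n.1 + n.2 = b]] =
    [set n | (n.1 != 0) && (n.2 != 0) /\ n.1 + n.2 = b].
  by apply/seteqP; split=> n /= => [[-> -> ->]|[/andP[]]].
rewrite sum_split_set fcoefM big_mkcond; apply: eq_bigr => -[n m] _ /=.
case: eqP => [->|_] /=; first by rewrite ?eqxx subrr mul0r.
by case: eqP => [->|_] /=; rewrite ?eqxx ?subrr ?mulr0 ?subr0.
Qed.

Lemma Wcoef_splits (A P : fseries mi M) b :
  Wcoef A P b = ((A - fconst (A 0)) * P - P * (A - fconst (A 0))) b.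
Proof.
rewrite /Wcoef sum_split_set fcoefB !fcoefM.
rewrite (splits_swap (fun n m => P n * (A - fconst (A 0)) m)) -sumrB big_mkcond.
apply: eq_bigr => -[n m] _ /=.
by case: eqP => [->|_] /=; rewrite ?eqxx ?subrr ?mul0r ?mulr0 ?subrr ?subr0.
Qed.
End SumsOverSplits.

Theorem theorem3p5 (R : realType) (d N : nat)
    (Params : set 'rV[R]_d) (A : 'rV[R]_d -> 'M[R[i]]_N) (mu0 : 'rV[R]_d)
    (Ac : multiindex d -> 'M[R[i]]_N)
    (lam0 : R[i]) (m0 : nat) (P0 S0 : 'M[R[i]]_N)
    (mu0_params : Params mu0)
    (params_nbhs : nbhs mu0 Params)
    (A_herm : forall mu, Params mu -> A mu \is hermsymmx)
    (A_analytic : power_series_near A mu0 Ac)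
    (lam0_isolated : isolated_eigenvalue (A mu0) lam0)
    (lam0_mult : \rank (eigenspace (A mu0) lam0) = m0)
    (P0_eigenproj : eigenprojector (A mu0) lam0 P0)
    (S0_resolvent : reduced_resolvent (A mu0) lam0 P0 S0) :
  exists (P : 'rV[R]_d -> 'M[R[i]]_N) (Pc : multiindex d -> 'M[R[i]]_N),
    [/\ P mu0 = P0,
        \forall mu \near mu0,
          orthogonal_projector (P mu) /\ P mu *m A mu = A mu *m P mu,
        power_series_near P mu0 Pc,
        [/\ Pc 0 = P0,
            forall b, (1 <= mi_deg b)%N -> Pc b = kato_coef P0 S0 Ac b,
            forall b, Pc b \is hermsymmx,
            forall b, (\rank (Pc b) <= m0 * \prod_(j < d) (b j).+1)%N &
            forall b, b != 0 ->
              Pc b = - (P0 *m Zcoef Pc b *m P0)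
                     + (1%:M - P0) *m Zcoef Pc b *m (1%:M - P0)
                     - S0 *m Wcoef Ac Pc b *m P0
                     - (S0 *m Wcoef Ac Pc b *m P0)^t*] &
        real_analytic_near (fun mu => \tr (A mu *m P mu) : R[i]^o) mu0].
Proof.
pose F : fseries (multiindex d) 'M[R[i]]_N := Series Ac.
have sg := @adjoint_antimorphism R N.
have [r1 r10 r1P] : exists2 r : R, 0 < r & forall mu,
    (forall j, `|(mu - mu0) 0 j| <= r) ->
    sums_to (ev (mu - mu0) F) (A mu) /\ (A mu)^t* = A mu.
  apply/near_polydisc; move/(power_series_nearP A mu0 F): A_analytic => A_analytic.
  near=> mu; split; first by near: mu.
  by apply/esym/eqP; rewrite -hermsymmxE; apply: A_herm; near: mu.
have [] := r1P mu0; first by move=> j; rewrite subrr mxE normr0 ltW.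
rewrite subrr ev0 => FA0 A0H.
have A0 := sums_to_unique FA0 (@sums_to_const R N _ (F 0)).
rewrite A0 in lam0_isolated lam0_mult P0_eigenproj S0_resolvent A0H.
have [PP PH] := P0_eigenproj.1; have [SP PS DS SD] := S0_resolvent.
have lam_eig : eigenvalue (F 0) lam0 by exact: isolatedS lam0_isolated.
have lamH := eigenvalue_real A0H P0_eigenproj lam_eig SD DS.
have SH := reduced_resolvent_adjoint A0H (esym PH) lamH S0_resolvent.
pose D := F 0 - lam0%:M.
have DP : D * P0 = 0.
  rewrite mulrBl -[F 0 * P0]/(F 0 *m P0) (eigenprojectorE P0_eigenproj).
  by rewrite -[lam0%:M * P0]/(lam0%:M *m P0) mul_scalar_mx subrr.
have PD : P0 * D = 0.
  have DH : D^t* = D.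
    by rewrite (antimorphismD sg) (antimorphismN sg) lamH A0H.
  transitivity ((D *m P0)^t*); first by rewrite trmx_mul map_mxM DH -PH.
  by rewrite -[D *m P0]/(D * P0) DP trmx0 map_mx0.
(* The radius is chosen for the perturbation to satisfy the smallness
   condition of [kato_series_bound]. *)
pose E := F - fconst (F 0).
have E1 : vanish 1 E.
  move=> b; rewrite ltnS leqn0 weight_eq0 => /eqP ->.
  by rewrite fcoefB fcoef_const eqxx subrr.
have FE : F = fconst (F 0) + E by rewrite addrC subrK.
pose c := 1 + nrm P0; pose s := 1 + nrm S0.
have cs0 : 0 < 8 * c * s by rewrite !mulr_gt0 // ltr_pwDl ?nrm_ge0.
have [r2 r20 Er2] : exists2 r2 : R, 0 < r2 &
    abs_bounded (ev (const_mx r2) E) (8 * c * s)^-1.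
  have [] := r1P (mu0 + const_mx r1).
    by move=> j; rewrite addrC addKr mxE gtr0_norm.
  rewrite addrC addKr => /sums_to_bounded[C FC] _.
  apply: (@small_radius _ _ _ E r1 C) => //; rewrite ?invr_gt0 //.
    by rewrite fcoefB fcoef_const eqxx subrr.
  move=> b; apply: le_trans (FC b); rewrite !evE !nrmZ ler_wpM2l //.
  rewrite fcoefB fcoef_const; case: eqP => [->|_]; rewrite ?subr0 //.
  by rewrite subrr nrm0 nrm_ge0.
have FC : abs_bounded (ev (const_mx r2) F) (nrm (F 0) + (8 * c * s)^-1).
  rewrite {1}FE evD ev_const.
  exact: abs_boundedD (@abs_bounded_const R N _ (F 0)) Er2.
pose K := kato_series P0 S0 E.
have KC : abs_bounded (ev (const_mx r2) K) (4 * c).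
  by apply: (kato_series_bound Er2); rewrite mulfV ?lt0r_neq0.
pose r := Num.min r1 r2; have r0 : 0 < r by rewrite lt_min r10.
have [rr1 rr2] : r <= r1 /\ r <= r2 by rewrite !ge_min !lexx orbT.
have FH b : (F b)^t* = F b.
  apply: (hermitian_coef (A := fun x => A (mu0 + x)) r0).
    apply: abs_bounded_ev FC => j; by rewrite mxE gtr0_norm.
  move=> x xr; have := r1P (mu0 + x); rewrite addrC addKr addrC; apply => j.
  by have /andP[xj0 xjr] := xr j; rewrite gtr0_norm // (le_trans xjr).
have EH b : (E b)^t* = E b.
  by rewrite fcoefB (antimorphismD sg) (antimorphismN sg) FH fcoef_const; case: eqP;
    rewrite ?FH ?trmx0 ?map_mx0.
have KH b : (K b)^t* = K b := kato_series_adjoint sg (esym PH) SH EH b.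
have KK : K * K = K := kato_series_idem DP PD SP PS DS SD E1.
have K0 : K 0 = P0 := kato_series0 P0 S0 E.
have KF : K * F = F * K.
  have lamK : fconst lam0%:M * K = K * fconst lam0%:M.
    apply: fseriesP => b; rewrite fcoef_constM fcoefM_const.
    by rewrite -[LHS]/(_ *m _) -[RHS]/(_ *m _) scalar_mxC.
  have := kato_series_comm DP PD SP PS DS SD E1; rewrite -/K.
  have -> : fconst D + E = F - fconst lam0%:M.
    by rewrite /D rmorphB addrAC -FE.
  by rewrite mulrBl mulrBr lamK => /addIr ->.
(* Away from the polydisc of convergence, the value is arbitrary. *)
pose P mu := xget 0 [set L | sums_to (ev (mu - mu0) K) L].
have PE mu : (forall j, `|(mu - mu0) 0 j| <= r) -> sums_to (ev (mu - mu0) K) (P mu).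
  move=> mur; have [|L KL] := @abs_bounded_sums R N _ (ev (mu - mu0) K) (4 * c).
    by apply: abs_bounded_ev KC => j; apply: le_trans rr2.
  exact: (xgetPex 0 (ex_intro _ L KL)).
have Pmu mu : (forall j, `|(mu - mu0) 0 j| <= r) ->
    [/\ orthogonal_projector (P mu), P mu *m A mu = A mu *m P mu &
        sums_to (ev (mu - mu0) (F * K)) (A mu *m P mu)].
  move=> mur; have KP := PE mu mur; have [FA _] := r1P mu (fun j => le_trans (mur j) rr1).
  have mur2 j : `|(mu - mu0) 0 j| <= r2 by apply: le_trans rr2.
  have Kb := abs_bounded_ev mur2 KC; have Fb := abs_bounded_ev mur2 FC.
  have KKP := sums_toM Kb Kb KP KP; rewrite -evM KK in KKP.
  have KFP := sums_toM Kb Fb KP FA; have FKP := sums_toM Fb Kb FA KP.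
  rewrite -!evM in KFP FKP; split=> //.
    split; first exact: sums_to_unique KP KKP.
    apply: (sums_to_unique KP); apply: eq_sums_to (sums_to_adjoint KP) => b.
    by rewrite ev_adjoint KH.
  by apply: (sums_to_unique KFP); rewrite KF.
exists P, K; split.
- have := PE mu0; rewrite subrr => /(_ _)/sums_to_unique; apply.
    by move=> j; rewrite mxE normr0 ltW.
  by rewrite ev0 K0; apply: sums_to_const.
- by apply/near_polydisc; exists r => // mu /Pmu[].
- by apply/power_series_nearP/near_polydisc; exists r.
- split=> [//|b b1|b|b|b b0].
  + by rewrite (@kato_coefE _ _ _ P0 S0 F) // -mi_deg_eq0 -lt0n.
  + by rewrite hermsymmxE KH.
  + apply: leq_trans (rank_idempotent_coef KK K0 (esym PP) b) _.
    rewrite -[splits b]/(mi_splits b) size_mi_splits leq_mul2r -lam0_mult.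
    by rewrite (rank_eigenprojector PD) orbT.
  + rewrite Zcoef_splits (Wcoef_splits F K) K0.
    have lamC (t : 'M[R[i]]_N) : lam0%:M * t = t * lam0%:M by exact: esym (scalar_mxC _ _).
    exact: (idempotent_recursion sg KF KK (esym PP) (esym PH) KH lamC DP SD b0).
- exists (fun b => \tr ((F * K) b)); apply/near_polydisc; exists r => // mu.
  move=> /Pmu[_ _ /sums_to_trace].
  have <- // : (fun b => \tr (ev (mu - mu0) (F * K) b)) =
    (fun b => (mi_pow (mu - mu0) b)%:C%C *: (\tr ((F * K) b) : R[i]^o)).
  by apply/funext => b; rewrite evE linearZ.
Unshelve. all: by end_near.
Qed.
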